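(* Let $\Bbbk$ be a field of characteristic $0$, $\mathcal U$ a non-principal ultrafilter on $\mathbb Z_{>0}$, and $K=\Bbbk^{\mathcal U}$ the ultrapower. The symmetric tensor category $\mathscr C_t=\varinjlim_m\underline{\mathrm{Rep}}\,P_{t,m}$ over $K$ has finite-dimensional morphism spaces, but has objects of infinite length.
   Context: A symmetric tensor category over a field $K$ is an essentially small $K$-linear abelian rigid symmetric monoidal category with $K$-linear tensor product and with $K\to\mathrm{End}(\mathbf 1)$ an isomorphism. A tensor functor is a linear exact monoidal functor. For integers $0\le m<n$, let $P_{n,m}\le GL_n$ (over $\Bbbk$) be the parabolic subgroup with Levi subgroup $GL_{n-m}\times GL_1^{\times m}$: writing $n\times n$ matrices in block form with $m+1$ diagonal blocks, the first of size $n-m$ and the others of size $1$, $P_{n,m}$ consists of the elements all of whose blocks below the diagonal are zero. Thus $P_{n,0}=GL_n$, $P_{n,n-1}$ is a Borel subgroup and $P_{n,m+1}\le P_{n,m}$. For $m\ge0$, $\mathcal U$ is also regarded as an ultrafilter on $\mathbb Z_{>m}\subset\mathbb Z_{>0}$, and the ultrapowers of $\Bbbk$ are all canonically identified with $K$. For fixed $m$, $\prod_{\mathcal U}\mathrm{Rep}_\Bbbk P_{n,m}$ (ultraproduct over $n\in\mathbb Z_{>m}$ of the categories of finite-dimensional rational representations) is a symmetric tensor category over $K$: objects are represented by sequences of objects, and morphism spaces are ultraproducts of the morphism spaces. Let $V[m]=(V_{m+1},V_{m+2},V_{m+3},\dots)$ be its object with components the natural representations $V_n$ of $GL_n$, $n>m$,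 restricted to $P_{n,m}$. Then $\underline{\mathrm{Rep}}\,P_{t,m}$ is the tensor subcategory generated by $V[m]$, i.e. the full subcategory of subquotients of finite direct sums of tensor products of copies of $V[m]$ and its dual. Here $t=(1,2,3,\dots)\in K$ is the categorical dimension of $V[m]$. The restriction functors $\mathrm{Rep}_\Bbbk P_{n,m}\to\mathrm{Rep}_\Bbbk P_{n,m+1}$ (for $n>m+1$) induce symmetric tensor functors $\underline{\mathrm{Rep}}\,P_{t,m}\to\underline{\mathrm{Rep}}\,P_{t,m+1}$, and $\mathscr C_t$ is the direct limit of $$\underline{\mathrm{Rep}}\,P_{t,0}\to\underline{\mathrm{Rep}}\,P_{t,1}\to\underline{\mathrm{Rep}}\,P_{t,2}\to\cdots.$$ *)

(* Defs.v *)
From HB Require Import structures.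
From mathcomp Require Import all_boot all_algebra generic_quotient.
From mathcomp Require Import boolp classical_sets filter.
From mathcomp Require Import mxtens zify.

Set Implicit Arguments.
Unset Strict Implicit.
Unset Printing Implicit Defensive.

Import GRing.Theory.
Local Open Scope ring_scope.
Local Open Scope quotient_scope.

Record lincat (K : fieldType) := LinCat {
  ob :> Type;
  mor : ob -> ob -> lmodType K;
  idm : forall X, mor X X;
  comp : forall X Y Z, mor Y Z -> mor X Y -> mor X Z;
  comp1m : forall X Y (f : mor X Y), comp (idm Y) f = f;
  compm1 : forall X Y (f : mor X Y), comp f (idm X) = f;
  compA : forall X Y Z T (h : mor Z T) (g : mor Y Z) (f : mor X Y),
    comp h (comp g f) = comp (comp h g) f;
  comp_linearl : forall X Y Z (f : mor X Y),
    linear (fun g : mor Y Z => comp g f);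
  comp_linearr : forall X Y Z (g : mor Y Z),
    linear (fun f : mor X Y => comp g f)
}.
Arguments idm {K l} X.

Section CategoricalNotions.
Context {K : fieldType} {C : lincat K}.
Implicit Types X Y Z : C.

Definition is_mono X Y (f : mor X Y) : Prop :=
  forall Z (g h : mor Z X), comp f g = comp f h -> g = h.

Definition is_epi X Y (f : mor X Y) : Prop :=
  forall Z (g h : mor Y Z), comp g f = comp h f -> g = h.

Definition is_iso X Y (f : mor X Y) : Prop :=
  exists g : mor Y X, comp g f = idm X /\ comp f g = idm Y.

Definition is_zero X : Prop := idm X = 0.

Definition is_coker X Y Q (f : mor X Y) (q : mor Y Q) : Prop :=
  comp q f = 0 /\
  forall Z (g : mor Y Z), comp g f = 0 -> exists! u : mor Q Z, comp u q = g.

Definition is_simple X : Prop :=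
  ~ is_zero X /\
  forall Y (i : mor Y X), is_mono i -> is_zero Y \/ is_iso i.

(** Existence of a Jordan-Hoelder filtration [0 = X_0 < X_1 < ... < X_r = X]
    with every [X_j / X_(j-1)] simple; [r] is the number of uses of the
    second constructor. *)
Inductive finite_length : C -> Prop :=
| finite_length0 X of is_zero X : finite_length X
| finite_lengthS Y X S (i : mor Y X) (q : mor X S) of
    is_mono i & is_coker i q & is_simple S & finite_length Y :
    finite_length X.

Definition is_subquotient X Y : Prop :=
  exists S (i : mor S Y) (p : mor S X), is_mono i /\ is_epi p.

End CategoricalNotions.

Definition findim (K : fieldType) (V : lmodType K) : Prop :=
  exists n, inhabited (Vector.axiom n V).

Record linfunctor (K : fieldType) (C D : lincat K) := LinFunctor {
  fob :> C -> D;
  fhom : forall X Y : C, {linear mor X Y -> mor (fob X) (fob Y)};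
  fhom_id : forall X, fhom X X (idm X) = idm (fob X);
  fhom_comp : forall X Y Z (g : mor Y Z) (f : mor X Y),
    fhom X Z (comp g f) = comp (fhom Y Z g) (fhom X Y f)
}.
Arguments fhom {K C D} l {X Y}.

Definition full_subcat (K : fieldType) (C : lincat K) (P : C -> Prop) :
  lincat K.
Proof.
refine (@LinCat K {X : C | P X} (fun X Y => mor (sval X) (sval Y))
  (fun X => idm (sval X)) (fun X Y Z g f => comp g f) _ _ _ _ _).
- by move=> X Y f; exact: comp1m.
- by move=> X Y f; exact: compm1.
- by move=> X Y Z T h g f; exact: compA.
- by move=> X Y Z f; exact: comp_linearl.
- by move=> X Y Z g; exact: comp_linearr.
Defined.

Record ultrafilter (I : Type) := Ultrafilter {
  uset :> set_system I;
  uset_ultra : UltraFilter uset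
}.
#[global] Existing Instance uset_ultra.

Definition nonprincipal (I : Type) (U : ultrafilter I) : Prop :=
  forall i, uset U <> principal_filter i.

Section Uprod.
Context {I : Type} (U : ultrafilter I) {k : fieldType}.
Implicit Types M N P : I -> lmodType k.

Definition uprod_rel M : rel (forall i, M i) :=
  fun f g => `[< uset U [set i | f i = g i]%classic >].

Lemma uprod_rel_refl M : reflexive (@uprod_rel M).
Proof. by move=> f; apply/asboolP; apply: filterE. Qed.

Lemma uprod_rel_sym M : symmetric (@uprod_rel M).
Proof.
by move=> f g; apply/asboolP/asboolP; apply: filterS => i /= ->.
Qed.

Lemma uprod_rel_trans M : transitive (@uprod_rel M).
Proof.
move=> g f h /asboolP fg /asboolP gh; apply/asboolP.
by apply: filterS2 fg gh => i /= -> ->.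
Qed.

Definition uprod_equiv M :=
  EquivRel (@uprod_rel M) (@uprod_rel_refl M) (@uprod_rel_sym M)
    (@uprod_rel_trans M).

Definition uprod M : Type := {eq_quot (uprod_equiv M)}.
HB.instance Definition _ M := Choice.on (uprod M).

Definition germ M (f : forall i, M i) : uprod M :=
  \pi_({eq_quot (uprod_equiv M)})%qT f.

Lemma germP M (f g : forall i, M i) :
  germ f = germ g <-> uset U [set i | f i = g i]%classic.
Proof.
by split=> [/eqquotP/asboolP | fg]; last apply/eqquotP/asboolP.
Qed.

Definition urepr M (x : uprod M) : forall i, M i :=
  repr (x : {eq_quot (uprod_equiv M)}).

Lemma ureprK M : cancel (@urepr M) (@germ M).
Proof. by move=> x; exact: reprK. Qed.

Lemma germ_surj M (x : uprod M) : exists f, x = germ f.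
Proof. by exists (urepr x); rewrite ureprK. Qed.

Lemma urepr_germ M (f : forall i, M i) :
  uset U [set i | urepr (germ f) i = f i]%classic.
Proof. by apply/germP; rewrite ureprK. Qed.

Definition umap (M N : I -> lmodType k) (t : forall i, M i -> N i)
  (x : uprod M) : uprod N := germ (fun i => t i (urepr x i)).

Lemma umap_germ M N (t : forall i, M i -> N i) f :
  umap t (germ f) = germ (fun i => t i (f i)).
Proof.
by apply/germP; apply: filterS (urepr_germ f) => i /= ->.
Qed.

Definition umap2 (M N P : I -> lmodType k) (t : forall i, M i -> N i -> P i)
  (x : uprod M) (y : uprod N) : uprod P :=
  germ (fun i => t i (urepr x i) (urepr y i)).

Lemma umap2_germ M N P (t : forall i, M i -> N i -> P i) f g :
  umap2 t (germ f) (germ g) = germ (fun i => t i (f i) (g i)).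
Proof.
apply/germP; apply: filterS2 (urepr_germ f) (urepr_germ g) => i /=.
by move=> -> ->.
Qed.

Definition uadd M := umap2 (fun i => @GRing.add (M i)).
Definition uopp M := umap (fun i => @GRing.opp (M i)).
Definition uzero M : uprod M := germ (fun=> 0).

Lemma uaddA M : associative (@uadd M).
Proof.
move=> x y z; rewrite -(ureprK x) -(ureprK y) -(ureprK z) /uadd !umap2_germ.
by congr germ; apply: functional_extensionality_dep => i; rewrite addrA.
Qed.

Lemma uaddC M : commutative (@uadd M).
Proof.
move=> x y; rewrite -(ureprK x) -(ureprK y) /uadd !umap2_germ.
by congr germ; apply: functional_extensionality_dep => i; rewrite addrC.
Qed.

Lemma uadd0 M : left_id (uzero M) (@uadd M).
Proof.
move=> x; rewrite -(ureprK x) /uadd !umap2_germ.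
by congr germ; apply: functional_extensionality_dep => i; rewrite add0r.
Qed.

Lemma uaddN M : left_inverse (uzero M) (@uopp M) (@uadd M).
Proof.
move=> x; rewrite -(ureprK x) /uadd /uopp umap_germ umap2_germ.
by congr germ; apply: functional_extensionality_dep => i; rewrite addNr.
Qed.

HB.instance Definition _ M :=
  GRing.isZmodule.Build (uprod M) (@uaddA M) (@uaddC M) (@uadd0 M) (@uaddN M).

Lemma germD M (f g : forall i, M i) :
  germ f + germ g = germ (fun i => f i + g i).
Proof. exact: umap2_germ. Qed.

Lemma germ0 M : 0 = germ (fun i => 0 : M i). Proof. by []. Qed.

Definition upower : Type := uprod (fun=> (k^o : lmodType k)).
HB.instance Definition _ := GRing.Zmodule.on upower.

Definition upower_germ (c : I -> k) : upower :=
  @germ (fun=> (k^o : lmodType k)) c.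
Definition upower_repr (c : upower) : I -> k := urepr c.

Definition umul : upower -> upower -> upower :=
  umap2 (fun i (a b : (k^o : lmodType k)) => (a : k) * (b : k) : k^o).
Definition uinv : upower -> upower :=
  umap (fun i (a : (k^o : lmodType k)) => (a : k)^-1 : k^o).
Definition uone : upower := upower_germ (fun=> 1).

Lemma upower_reprK c : upower_germ (upower_repr c) = c.
Proof. exact: ureprK. Qed.

Lemma upower_germP a b :
  upower_germ a = upower_germ b <-> uset U [set i | a i = b i]%classic.
Proof. exact: germP. Qed.

Lemma umul_germ a b :
  umul (upower_germ a) (upower_germ b) = upower_germ (fun i => a i * b i).
Proof. exact: umap2_germ. Qed.

Lemma uadd_germ a b :
  upower_germ a + upower_germ b = upower_germ (fun i => a i + b i).
Proof. exact: germD. Qed.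

Lemma umulA : associative umul.
Proof.
move=> x y z; rewrite -(upower_reprK x) -(upower_reprK y) -(upower_reprK z).
by rewrite !umul_germ; congr upower_germ; apply: funext => i; rewrite mulrA.
Qed.

Lemma umulC : commutative umul.
Proof.
move=> x y; rewrite -(upower_reprK x) -(upower_reprK y).
by rewrite !umul_germ; congr upower_germ; apply: funext => i; rewrite mulrC.
Qed.

Lemma umul1 : left_id uone umul.
Proof.
move=> x; rewrite -(upower_reprK x) umul_germ.
by congr upower_germ; apply: funext => i; rewrite mul1r.
Qed.

Lemma umulDl : left_distributive umul +%R.
Proof.
move=> x y z; rewrite -(upower_reprK x) -(upower_reprK y) -(upower_reprK z).
rewrite uadd_germ !umul_germ uadd_germ.
by congr upower_germ; apply: funext => i; rewrite mulrDl.
Qed.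

Lemma uone_neq0 : uone != 0.
Proof.
apply/eqP => /upower_germP /filter_ex[i] /= /eqP.
by rewrite oner_eq0.
Qed.

HB.instance Definition _ :=
  GRing.Zmodule_isComNzRing.Build upower umulA umulC umul1 umulDl uone_neq0.

Lemma umulV (x : upower) : x != 0 -> uinv x * x = 1.
Proof.
rewrite -(upower_reprK x); set c := upower_repr x => /eqP c0.
have -> : uinv (upower_germ c) = upower_germ (fun i => (c i)^-1).
  exact: umap_germ.
rewrite [_ * _]umul_germ; apply/upower_germP.
have [cz|] := in_ultra_setVsetC [set i | c i = 0]%classic (uset_ultra U).
  by case: c0; apply/upower_germP.
by apply: filterS => i /= /eqP ci0; rewrite mulVf.
Qed.

Lemma uinv0 : uinv 0 = 0.
Proof.
rewrite [LHS]umap_germ; apply/upower_germP.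
by apply: filterE => i /=; rewrite invr0.
Qed.

HB.instance Definition _ := GRing.ComNzRing_isField.Build upower umulV uinv0.

Definition uscale M (c : upower) (x : uprod M) : uprod M :=
  umap2 (fun i (a : (k^o : lmodType k)) (v : M i) => (a : k) *: v) c x.

Lemma uscale_germ M (c : I -> k) (f : forall i, M i) :
  uscale (upower_germ c) (germ f) = germ (fun i => c i *: f i).
Proof. exact: umap2_germ. Qed.

Lemma uscaleA M (a b : upower) (x : uprod M) :
  uscale a (uscale b x) = uscale (a * b) x.
Proof.
rewrite -(upower_reprK a) -(upower_reprK b) -(ureprK x) [_ * _]umul_germ.
rewrite !uscale_germ; congr germ; apply: functional_extensionality_dep => i.
by rewrite scalerA.
Qed.

Lemma uscale1 M : left_id 1 (@uscale M).
Proof.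
move=> x; rewrite -(ureprK x) uscale_germ; congr germ.
by apply: functional_extensionality_dep => i; rewrite scale1r.
Qed.

Lemma uscaleDr M : right_distributive (@uscale M) +%R.
Proof.
move=> a x y; rewrite -(upower_reprK a) -(ureprK x) -(ureprK y) germD.
rewrite !uscale_germ germD; congr germ.
by apply: functional_extensionality_dep => i; rewrite scalerDr.
Qed.

Lemma uscaleDl M x : {morph (@uscale M)^~ x : a b / a + b}.
Proof.
move=> a b; rewrite -(upower_reprK a) -(upower_reprK b) -(ureprK x) uadd_germ.
rewrite !uscale_germ germD; congr germ.
by apply: functional_extensionality_dep => i; rewrite scalerDl.
Qed.

HB.instance Definition _ M := GRing.Zmodule_isLmodule.Build upower (uprod M)
  (@uscaleA M) (@uscale1 M) (@uscaleDr M) (@uscaleDl M).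

Lemma germZ M (c : I -> k) (f : forall i, M i) :
  upower_germ c *: germ f = germ (fun i => c i *: f i).
Proof. exact: uscale_germ. Qed.

Section UmapLinear.
Variables (M N : I -> lmodType k) (t : forall i, {linear M i -> N i}).

Definition ulin : uprod M -> uprod N := umap (fun i => t i).

Lemma ulin_germ f : ulin (germ f) = germ (fun i => t i (f i)).
Proof. exact: umap_germ. Qed.

Lemma ulin_is_linear : linear ulin.
Proof.
move=> c x y; rewrite -(upower_reprK c) -(ureprK x) -(ureprK y).
rewrite germZ germD !ulin_germ germZ germD; congr germ.
by apply: functional_extensionality_dep => i; rewrite linearP.
Qed.

HB.instance Definition _ :=
  GRing.isLinear.Build upower (uprod M) (uprod N) *:%R ulin ulin_is_linear.

End UmapLinear.

End Uprod.
Arguments upower {I} U k.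
Arguments uprod {I} U {k} M.
Arguments germ {I} U {k M} f.

Definition ultraproduct (I : Type) (U : ultrafilter I) (k : fieldType)
  (C : I -> lincat k) : lincat (upower U k).
Proof.
refine (@LinCat (upower U k) (forall i, C i)
  (fun X Y => uprod U (fun i => mor (X i) (Y i)))
  (fun X => germ U (fun i => idm (X i)))
  (fun X Y Z => umap2 (fun i => @comp k (C i) (X i) (Y i) (Z i))) _ _ _ _ _).
- move=> X Y f; rewrite -(ureprK f) umap2_germ; congr germ.
  by apply: functional_extensionality_dep => i; rewrite comp1m.
- move=> X Y f; rewrite -(ureprK f) umap2_germ; congr germ.
  by apply: functional_extensionality_dep => i; rewrite compm1.
- move=> X Y Z T h g f; rewrite -(ureprK f) -(ureprK g) -(ureprK h) !umap2_germ.
  by congr germ; apply: functional_extensionality_dep => i; rewrite compA.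
- move=> X Y Z f c g h.
  rewrite -(upower_reprK c) -(ureprK f) -(ureprK g) -(ureprK h).
  rewrite germZ germD !umap2_germ germZ germD; congr germ.
  by apply: functional_extensionality_dep => i; rewrite comp_linearl.
- move=> X Y Z g c f h.
  rewrite -(upower_reprK c) -(ureprK f) -(ureprK g) -(ureprK h).
  rewrite germZ germD !umap2_germ germZ germD; congr germ.
  by apply: functional_extensionality_dep => i; rewrite comp_linearr.
Defined.

Section Parabolic.
Context {k : fieldType}.

(** The block of index [i] for the composition [(n - m, 1, ..., 1)] of [n],
    with rows and blocks numbered from [0]: the first [n - m] indices lie in
    block [0], and the following ones in blocks [1], ..., [m]. For [n <= m]
    the truncated subtraction gives blocks of size [1]. *)
Definition blk n m (i : 'I_n) : nat := (i.+1 - (n - m))%N.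

Definition parab n m : {pred 'M[k]_n} :=
  [pred g | (g \in unitmx) &&
    [forall i, forall j, (blk m j < blk m i)%N ==> (g i j == 0)]].
Arguments parab : clear implicits.

Lemma parabP n m (g : 'M[k]_n) :
  reflect (g \in unitmx /\ forall i j, (blk m j < blk m i)%N -> g i j = 0)
    (g \in parab n m).
Proof.
apply: (iffP andP) => -[gu gP]; split=> //.
  by move=> i j ij; apply/eqP; move/forallP/(_ i)/forallP/(_ j)/implyP: gP; apply.
apply/forallP => i; apply/forallP => j; apply/implyP => ij.
by rewrite gP.
Qed.

Lemma parab_unit n m (g : 'M[k]_n) : g \in parab n m -> g \in unitmx.
Proof. by case/parabP. Qed.

Lemma parab1 n m : 1%:M \in parab n m.
Proof.
apply/parabP; split; first exact: unitmx1.
by move=> i j ij; rewrite mxE; case: eqP ij => // ->; rewrite ltnn.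
Qed.

Lemma parabM n m (g h : 'M[k]_n) :
  g \in parab n m -> h \in parab n m -> g *m h \in parab n m.
Proof.
move=> /parabP[gu gP] /parabP[hu hP]; apply/parabP; split.
  by rewrite unitmx_mul gu.
move=> i j ij; rewrite mxE big1 // => l _.
have [li|il] := ltnP (blk m l) (blk m i); first by rewrite gP ?mul0r.
by rewrite hP ?mulr0 // (leq_trans ij).
Qed.

Lemma parabV n m (g : 'M[k]_n) : g \in parab n m -> invmx g \in parab n m.
Proof.
move=> /parabP[gu gP]; apply/parabP; split; first by rewrite unitmx_inv.
move=> i j ij; set t := blk m i.
pose D : 'M[k]_n := diag_mx (\row_l (t <= blk m l)%N%:R).
have De (A : 'M[k]_n) a b : (A *m D) a b = A a b * (t <= blk m b)%N%:R.
  by rewrite mul_mx_diag !mxE.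
have De' (A : 'M[k]_n) a b : (D *m A) a b = (t <= blk m a)%N%:R * A a b.
  by rewrite mul_diag_mx !mxE.
have Dg : (D *m g <= D)%MS.
  suff -> : D *m g = D *m g *m D by exact: submxMl.
  apply/matrixP => a b; rewrite De De'.
  case: (leqP t (blk m a)) => ta; rewrite ?mul0r // mul1r.
  case: (leqP t (blk m b)) => tb; rewrite ?mulr1 // mulr0 gP //.
  exact: leq_trans ta.
have gD : (D <= D *m g)%MS.
  by move: (mxrank_leqif_sup Dg) => [_ <-]; rewrite mxrankMfree ?row_free_unit.
have /submxP[B DB] : (D *m invmx g <= D)%MS.
  by rewrite -[X in (_ <= X)%MS](mulmxK gu) submxMr.
have := De' (invmx g) i j; rewrite leqnn mul1r => <-.
by rewrite DB De leqNgt ij mulr0.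
Qed.

Lemma parab_sub n m l (g : 'M[k]_n) :
  (m <= l)%N -> g \in parab n l -> g \in parab n m.
Proof.
move=> ml /parabP[gu gP]; apply/parabP; split=> // i j ij; apply: gP.
by move: ij; rewrite /blk; lia.
Qed.

Lemma invmx_mul n (g h : 'M[k]_n) : g \in unitmx -> h \in unitmx ->
  invmx (g *m h) = invmx h *m invmx g.
Proof.
move=> gu hu; have ghu : g *m h \in unitmx by rewrite unitmx_mul gu.
apply: (can_inj (mulKmx ghu)).
by rewrite mulmxV // -mulmxA (mulKVmx hu) mulmxV.
Qed.

(** The regular functions on [GL_n(k)]: the [k]-algebra of functions generated
    by the matrix entries and the inverse of the determinant. *)
Inductive regular n : ('M[k]_n -> k) -> Prop :=
| regular_const c : regular (fun=> c)
| regular_entry i j : regular (fun g => g i j)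
| regular_detV : regular (fun g => (\det g)^-1)
| regular_add f1 f2 of regular f1 & regular f2 :
    regular (fun g => f1 g + f2 g)
| regular_mul f1 f2 of regular f1 & regular f2 :
    regular (fun g => f1 g * f2 g).

Lemma regular_sum n (I : finType) (f : I -> 'M[k]_n -> k) :
  (forall i, regular (f i)) -> regular (fun g => \sum_i f i g).
Proof.
move=> fr; elim: (index_enum I) => [|i s IH].
  rewrite (_ : (fun _ => _) = fun=> 0); first exact: regular_const.
  by apply: funext => g; rewrite big_nil.
rewrite (_ : (fun _ => _) = fun g => f i g + \sum_(i <- s) f i g).
  exact: regular_add.
by apply: funext => g; rewrite big_cons.
Qed.

Lemma regular_prod n (I : finType) (f : I -> 'M[k]_n -> k) :
  (forall i, regular (f i)) -> regular (fun g => \prod_i f i g).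
Proof.
move=> fr; elim: (index_enum I) => [|i s IH].
  rewrite (_ : (fun _ => _) = fun=> 1); first exact: regular_const.
  by apply: funext => g; rewrite big_nil.
rewrite (_ : (fun _ => _) = fun g => f i g * \prod_(i <- s) f i g).
  exact: regular_mul.
by apply: funext => g; rewrite big_cons.
Qed.

Lemma regular_det n d (A : 'M[k]_n -> 'M[k]_d) :
  (forall i j, regular (fun g => A g i j)) -> regular (fun g => \det (A g)).
Proof.
move=> Ar; apply: regular_sum => s; apply: regular_mul.
  exact: regular_const.
by apply: regular_prod => i.
Qed.

Lemma regular_inv n (f : 'M[k]_n -> k) : regular f ->
  exists2 f', regular f' & {in unitmx, forall g, f (invmx g) = f' g}.
Proof.
elim=> [c|i j||f1 f2 _ [f1' r1 e1] _ [f2' r2 e2]|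
    f1 f2 _ [f1' r1 e1] _ [f2' r2 e2]].
- by exists (fun=> c) => //; exact: regular_const.
- exists (fun g => (\det g)^-1 * cofactor g j i).
    apply: regular_mul; first exact: regular_detV.
    apply: regular_mul; first exact: regular_const.
    apply: regular_det => a b.
    rewrite (_ : (fun _ => _) = fun g : 'M_n => g (lift j a) (lift i b)).
      exact: regular_entry.
    by apply: funext => g; rewrite !mxE.
  by move=> g gu; rewrite /invmx gu !mxE.
- exists (fun g => \det g); first by apply: regular_det; exact: regular_entry.
  by move=> g gu; rewrite det_inv invrK.
- exists (fun g => f1' g + f2' g); first exact: regular_add.
  by move=> g gu; rewrite e1 ?e2.
- exists (fun g => f1' g * f2' g); first exact: regular_mul.
  by move=> g gu; rewrite e1 ?e2.
Qed.

Record prerep n := Prerep {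
  rdim : nat;
  ract : 'M[k]_n -> 'M[k]_rdim
}.

(** [ract] restricts to a rational representation of [parab n m] on the space
    of column vectors of size [rdim]: a homomorphism to [GL_rdim(k)] whose
    matrix coefficients are restrictions of regular functions on [GL_n]. In
    characteristic [0] the field [k] is infinite, so that the [k]-points of
    [P_(n,m)], an open subscheme of an affine space, are dense: such
    homomorphisms are the same as representations of the algebraic group. *)
Record is_rational n m (X : prerep n) : Prop := IsRational {
  rat1 : ract X 1%:M = 1%:M;
  ratM : {in parab n m &, forall g h, ract X (g *m h) = ract X g *m ract X h};
  rat_regular : forall i j,
    exists2 f, regular f & {in parab n m, forall g, ract X g i j = f g}
}.

Lemma rat_regular_mul n m (X : prerep n) p q (A : 'M[k]_(p, _))
    (B : 'M[k]_(_, q)) i j : is_rational m X ->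
  exists2 f, regular f &
    {in parab n m, forall g, (A *m ract X g *m B) i j = f g}.
Proof.
move=> Xrat.
have fex ab : exists f, regular f /\
    {in parab n m, forall g, ract X g ab.1 ab.2 = f g}.
  by case: (rat_regular Xrat ab.1 ab.2) => f; exists f.
have [f fP] := choice fex.
exists (fun g => \sum_a (\sum_b A i b * f (b, a) g) * B a j).
  apply: regular_sum => a; apply: regular_mul; last exact: regular_const.
  apply: regular_sum => b; apply: regular_mul; first exact: regular_const.
  by case: (fP (b, a)).
move=> g gP; rewrite mxE; apply: eq_bigr => a _; rewrite mxE; congr (_ * _).
by apply: eq_bigr => b _; case: (fP (b, a)) => _ <-.
Qed.

Record rep n m := Rep {
  rep_pre :> prerep n;
  repP : is_rational m rep_pre
}.

Definition equivariant n m (X Y : prerep n) : {pred 'M[k]_(rdim Y, rdim X)} :=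
  [pred F | `[< {in parab n m, forall g, F *m ract X g = ract Y g *m F} >]].
Arguments equivariant {n} m X Y.

Lemma equivariantP n m (X Y : prerep n) (F : 'M[k]_(rdim Y, rdim X)) :
  reflect {in parab n m, forall g, F *m ract X g = ract Y g *m F}
    (F \in equivariant m X Y).
Proof. exact: asboolP. Qed.

Lemma equivariant_submod n m (X Y : prerep n) : submod_closed (equivariant m X Y).
Proof.
split=> [|c F G /equivariantP FP /equivariantP GP].
  by apply/equivariantP => g _; rewrite mul0mx mulmx0.
apply/equivariantP => g gP.
by rewrite mulmxDl mulmxDr -scalemxAl -scalemxAr FP ?GP.
Qed.
HB.instance Definition _ n m (X Y : prerep n) :=
  GRing.isSubmodClosed.Build k _ (equivariant m X Y) (@equivariant_submod n m X Y).

Record equivar n m (X Y : prerep n) := Equivar {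
  emx :> 'M[k]_(rdim Y, rdim X);
  emxP : emx \in equivariant m X Y
}.
Arguments equivar {n} m X Y.
HB.instance Definition _ n m (X Y : prerep n) := [isSub for @emx n m X Y].
HB.instance Definition _ n m (X Y : prerep n) := [Choice of equivar m X Y by <:].
HB.instance Definition _ n m (X Y : prerep n) :=
  [SubChoice_isSubLmodule of equivar m X Y by <:].

Lemma equivarP n m (X Y : prerep n) (F : equivar m X Y) g :
  g \in parab n m -> emx F *m ract X g = ract Y g *m emx F.
Proof. by move: g; exact/equivariantP/emxP. Qed.

Lemma equivar_id_subproof n m (X : prerep n) : 1%:M \in equivariant m X X.
Proof. by apply/equivariantP => g _; rewrite mul1mx mulmx1. Qed.
Definition equivar_id n m (X : prerep n) : equivar m X X :=
  Equivar (equivar_id_subproof m X).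

Lemma equivar_comp_subproof n m (X Y Z : prerep n)
  (G : equivar m Y Z) (F : equivar m X Y) :
  emx G *m emx F \in equivariant m X Z.
Proof.
by apply/equivariantP => g gP; rewrite -mulmxA equivarP // !mulmxA equivarP.
Qed.
Definition equivar_comp n m (X Y Z : prerep n)
  (G : equivar m Y Z) (F : equivar m X Y) : equivar m X Z :=
  Equivar (equivar_comp_subproof G F).

Definition RepP (n m : nat) : lincat k.
Proof.
refine (@LinCat k (rep n m) (fun X Y => equivar m X Y : lmodType k)
  (fun X => equivar_id m X) (fun X Y Z => @equivar_comp n m X Y Z) _ _ _ _ _).
- by move=> X Y f; apply: val_inj; rewrite /= mul1mx.
- by move=> X Y f; apply: val_inj; rewrite /= mulmx1.
- by move=> X Y Z T h g f; apply: val_inj; rewrite /= mulmxA.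
- by move=> X Y Z f c g h; apply: val_inj; rewrite /= mulmxDl -scalemxAl.
- by move=> X Y Z g c f h; apply: val_inj; rewrite /= mulmxDr -scalemxAr.
Defined.

Definition nat_prerep (n : nat) : prerep n := Prerep id.

Definition triv_prerep (n : nat) : prerep n := Prerep (fun=> 1%:M : 'M_1).

Definition zero_prerep (n : nat) : prerep n := Prerep (fun=> 1%:M : 'M_0).

Definition dual_prerep n (X : prerep n) : prerep n :=
  Prerep (fun g => (ract X (invmx g))^T).

Definition tens_prerep n (X Y : prerep n) : prerep n :=
  Prerep (fun g => tensmx (ract X g) (ract Y g)).

Definition dsum_prerep n (X Y : prerep n) : prerep n :=
  Prerep (fun g => block_mx (ract X g) 0 0 (ract Y g)).

Lemma nat_rational n m : is_rational m (nat_prerep n).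
Proof.
split=> // i j; exists (fun g : 'M_n => g i j) => //; exact: regular_entry.
Qed.

Lemma triv_rational n m : is_rational m (triv_prerep n).
Proof.
split=> // [g h _ _ /=|i j]; first by rewrite mulmx1.
by exists (fun=> (1%:M : 'M_1) i j) => //; exact: regular_const.
Qed.

Lemma zero_rational n m : is_rational m (zero_prerep n).
Proof. by split=> // [g h _ _ /=|[]//]; rewrite mulmx1. Qed.

Lemma dual_rational n m (X : rep n m) : is_rational m (dual_prerep X).
Proof.
split=> /= [|g h gP hP|i j].
- by rewrite invmx1 (rat1 (repP X)) trmx1.
- rewrite invmx_mul ?(parab_unit gP) ?(parab_unit hP) //.
  by rewrite (ratM (repP X)) ?parabV // trmx_mul.
- have [f fr fE] := rat_regular (repP X) j i.
  have [f' fr' fE'] := regular_inv fr.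
  exists f' => // g gP; rewrite mxE fE ?parabV // fE' //.
  exact: parab_unit gP.
Qed.

Lemma tens_rational n m (X Y : rep n m) : is_rational m (tens_prerep X Y).
Proof.
split=> /= [|g h gP hP|i j].
- rewrite (rat1 (repP X)) (rat1 (repP Y)); apply/matrixP => a b.
  case: (mxtens_indexP a) => a1 a2; case: (mxtens_indexP b) => b1 b2.
  rewrite tensmxE !mxE -natrM mulnb; congr (_ %:R); congr nat_of_bool.
  apply/andP/eqP => [[/eqP-> /eqP->//]|].
  by move/(can_inj (@mxtens_indexK _ _)) => [-> ->].
- by rewrite (ratM (repP X)) // (ratM (repP Y)) // tensmx_mul.
- case: (mxtens_indexP i) => i1 i2; case: (mxtens_indexP j) => j1 j2.
  have [f fr fE] := rat_regular (repP X) i1 j1.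
  have [f' fr' fE'] := rat_regular (repP Y) i2 j2.
  exists (fun g => f g * f' g); first exact: regular_mul.
  by move=> g gP; rewrite tensmxE fE ?fE'.
Qed.

Lemma dsum_rational n m (X Y : rep n m) : is_rational m (dsum_prerep X Y).
Proof.
split=> /= [|g h gP hP|i j].
- by rewrite (rat1 (repP X)) (rat1 (repP Y)) -scalar_mx_block.
- rewrite (ratM (repP X)) // (ratM (repP Y)) // mulmx_block.
  by rewrite !mul0mx !mulmx0 !addr0 add0r.
- rewrite -[i]splitK -[j]splitK; case: (split i) (split j) => [a|a] [b|b] /=.
  + have [f fr fE] := rat_regular (repP X) a b.
    by exists f => // g gP; rewrite block_mxEul fE.
  + exists (fun=> 0); first exact: regular_const.
    by move=> g _; rewrite block_mxEur mxE.
  + exists (fun=> 0); first exact: regular_const.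
    by move=> g _; rewrite block_mxEdl mxE.
  + have [f fr fE] := rat_regular (repP Y) a b.
    by exists f => // g gP; rewrite block_mxEdr fE.
Qed.

Definition nat_rep (n m : nat) : rep n m := Rep (nat_rational n m).
Definition triv_rep (n m : nat) : rep n m := Rep (triv_rational n m).
Definition zero_rep (n m : nat) : rep n m := Rep (zero_rational n m).
Definition dual_rep n m (X : rep n m) : rep n m := Rep (dual_rational X).
Definition tens_rep n m (X Y : rep n m) : rep n m := Rep (tens_rational X Y).
Definition dsum_rep n m (X Y : rep n m) : rep n m := Rep (dsum_rational X Y).

Lemma res_rational n m l (X : rep n m) : (m <= l)%N -> is_rational l X.
Proof.
move=> ml; split=> [|g h gP hP|i j]; first exact: rat1 (repP X).
- by apply: (ratM (repP X)); exact: parab_sub ml _.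
- have [f fr fE] := rat_regular (repP X) i j.
  by exists f => // g gP; rewrite fE // (parab_sub ml).
Qed.

Definition res_rep n m l (ml : (m <= l)%N) (X : rep n m) : rep n l :=
  Rep (res_rational X ml).

Lemma res_equivar_subproof n m l (ml : (m <= l)%N) (X Y : prerep n)
  (F : equivar m X Y) : emx F \in equivariant l X Y.
Proof. by apply/equivariantP => g /(parab_sub ml) /(equivarP F). Qed.

Definition res_equivar n m l (ml : (m <= l)%N) (X Y : prerep n)
  (F : equivar m X Y) : equivar l X Y := Equivar (res_equivar_subproof ml F).

Lemma res_equivar_is_linear n m l (ml : (m <= l)%N) (X Y : prerep n) :
  linear (@res_equivar n m l ml X Y).
Proof. by move=> c F G; apply: val_inj. Qed.
HB.instance Definition _ n m l (ml : (m <= l)%N) (X Y : prerep n) :=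
  GRing.isLinear.Build k (equivar m X Y) (equivar l X Y)
    *:%R (@res_equivar n m l ml X Y) (@res_equivar_is_linear n m l ml X Y).

Section Kernel.
Variables (n m : nat) (X Y : rep n m) (F : equivar m X Y).

Let R := row_base (kermx (emx F)^T).
Let B := R^T.
Let L := (pinvmx R)^T.

Let LB : L *m B = 1%:M.
Proof. by rewrite /L /B -trmx_mul mulmxVp ?row_base_free ?trmx1. Qed.

Let FB : emx F *m B = 0.
Proof.
apply: trmx_inj; rewrite trmx_mul trmxK trmx0; apply/sub_kermxP.
by rewrite eq_row_base.
Qed.

Let BL p (v : 'M_(_, p)) : emx F *m v = 0 -> B *m (L *m v) = v.
Proof.
move=> Fv; apply: trmx_inj; rewrite !trmx_mul !trmxK mulmxKpV //.
by rewrite eq_row_base; apply/sub_kermxP; rewrite -trmx_mul Fv trmx0.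
Qed.

Definition ker_prerep : prerep n := Prerep (fun g => L *m ract X g *m B).

Let BLg g : g \in parab n m ->
  B *m (L *m (ract X g *m B)) = ract X g *m B.
Proof.
by move=> gP; apply: BL; rewrite mulmxA equivarP // -mulmxA FB mulmx0.
Qed.

Lemma ker_rational : is_rational m ker_prerep.
Proof.
split=> /= [|g h gP hP|i j].
- by rewrite (rat1 (repP X)) mulmx1.
- rewrite (ratM (repP X)) // -!mulmxA; congr (_ *m (_ *m _)).
  by rewrite BLg.
- exact: rat_regular_mul (repP X).
Qed.
Definition ker_rep : rep n m := Rep ker_rational.

Lemma ker_incl_subproof : B \in equivariant m ker_rep X.
Proof. by apply/equivariantP => g gP /=; rewrite -!mulmxA BLg. Qed.
Definition ker_incl : equivar m ker_rep X := Equivar ker_incl_subproof.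

Lemma ker_inclK : equivar_comp F ker_incl = 0.
Proof. exact: val_inj. Qed.

Lemma ker_incl_eq0 : ker_incl = 0 -> row_free (emx F)^T.
Proof.
move=> /(congr1 val) /= B0; rewrite -kermx_eq0 -(eqmx_eq0 (eq_row_base _)).
by rewrite -[X in X == _]trmxK -/R -/B B0 trmx0.
Qed.

End Kernel.

Section Cokernel.
Variables (n m : nat) (X Y : rep n m) (F : equivar m X Y).

Let Q := row_base (kermx (emx F)).
Let S := pinvmx Q.

Let QS : Q *m S = 1%:M.
Proof. by rewrite mulmxVp ?row_base_free. Qed.

Let QF : Q *m emx F = 0.
Proof. by apply/sub_kermxP; rewrite eq_row_base. Qed.

Let SQ p (v : 'M_(p, _)) : v *m emx F = 0 -> v *m S *m Q = v.
Proof. by move=> Fv; rewrite mulmxKpV // eq_row_base; apply/sub_kermxP. Qed.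

Definition coker_prerep : prerep n := Prerep (fun g => Q *m ract Y g *m S).

Let gSQ g : g \in parab n m -> Q *m ract Y g *m S *m Q = Q *m ract Y g.
Proof.
by move=> gP; apply: SQ; rewrite -mulmxA -equivarP // mulmxA QF mul0mx.
Qed.

Lemma coker_rational : is_rational m coker_prerep.
Proof.
split=> /= [|g h gP hP|i j].
- by rewrite (rat1 (repP Y)) mulmx1.
- transitivity (Q *m ract Y g *m S *m Q *m (ract Y h *m S)).
    by rewrite gSQ // (ratM (repP Y)) // -!mulmxA.
  by rewrite -!mulmxA.
- exact: rat_regular_mul (repP Y).
Qed.
Definition coker_rep : rep n m := Rep coker_rational.

Lemma coker_proj_subproof : Q \in equivariant m Y coker_rep.
Proof. by apply/equivariantP => g gP /=; rewrite gSQ. Qed.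
Definition coker_proj : equivar m Y coker_rep := Equivar coker_proj_subproof.

Lemma coker_projK : equivar_comp coker_proj F = 0.
Proof. exact: val_inj. Qed.

Lemma coker_proj_eq0 : coker_proj = 0 -> row_free (emx F).
Proof.
move=> /(congr1 val) /= Q0; rewrite -kermx_eq0 -(eqmx_eq0 (eq_row_base _)).
by rewrite -/Q Q0.
Qed.

End Cokernel.

End Parabolic.
Arguments RepP k n m : clear implicits.
Arguments nat_rep k n m : clear implicits.
Arguments triv_rep k n m : clear implicits.
Arguments zero_rep k n m : clear implicits.

Record seqsys (K : fieldType) := Seqsys {
  sobj :> nat -> lmodType K;
  strans : forall a b, (a <= b)%N -> {linear sobj a -> sobj b};
  strans_id : forall a (h : (a <= a)%N) x, strans h x = x;
  strans_comp : forall a b c (ab : (a <= b)%N) (bc : (b <= c)%N)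
    (ac : (a <= c)%N) x, strans bc (strans ab x) = strans ac x
}.

Section Seqlim.
Context {K : fieldType} (A : seqsys K).

Definition seqlim_rel : rel {a : nat & A a} := fun x y =>
  `[< exists c (ac : (tag x <= c)%N) (bc : (tag y <= c)%N),
        strans A ac (tagged x) = strans A bc (tagged y) >].

Lemma seqlim_rel_refl : reflexive seqlim_rel.
Proof. by move=> x; apply/asboolP; exists (tag x), (leqnn _), (leqnn _). Qed.

Lemma seqlim_rel_sym : symmetric seqlim_rel.
Proof.
by move=> x y; apply/asboolP/asboolP => -[c [h1 [h2 e]]]; exists c, h2, h1.
Qed.

Lemma seqlim_rel_trans : transitive seqlim_rel.
Proof.
move=> y x z /asboolP[c [xc [yc e]]] /asboolP[d [yd [zd e']]]; apply/asboolP.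
have cm := leq_maxl c d; have dm := leq_maxr c d.
exists (maxn c d), (leq_trans xc cm), (leq_trans zd dm).
rewrite -(strans_comp xc cm) e -(strans_comp zd dm) -e'.
by rewrite (strans_comp _ _ (leq_trans yc cm)) (strans_comp _ _ (leq_trans yc cm)).
Qed.

Definition seqlim_equiv :=
  EquivRel seqlim_rel seqlim_rel_refl seqlim_rel_sym seqlim_rel_trans.

Definition seqlim : Type := {eq_quot seqlim_equiv}.
HB.instance Definition _ := Choice.on seqlim.

Definition sinj a (x : A a) : seqlim :=
  \pi_({eq_quot seqlim_equiv})%qT (Tagged (fun a => A a : Type) x).

Lemma sinjP a b (x : A a) (y : A b) : sinj x = sinj y <->
  exists c (ac : (a <= c)%N) (bc : (b <= c)%N), strans A ac x = strans A bc y.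
Proof. by split=> [/eqquotP/asboolP | e]; last apply/eqquotP/asboolP. Qed.

Lemma sinj_trans a b (ab : (a <= b)%N) (x : A a) : sinj (strans A ab x) = sinj x.
Proof. by apply/sinjP; exists b, (leqnn b), ab; rewrite strans_id. Qed.

Lemma sinj_surj (x : seqlim) : exists a (y : A a), x = sinj y.
Proof.
exists (tag (repr (x : {eq_quot seqlim_equiv}))), (tagged (repr x)).
by rewrite /sinj; case: (repr x) (reprK x) => a y <-.
Qed.

Definition smap (T : Type) (f : forall a, A a -> T) (x : seqlim) : T :=
  f _ (tagged (repr (x : {eq_quot seqlim_equiv}))).

Lemma smap_inj T (f : forall a, A a -> T) :
  (forall a b (ab : (a <= b)%N) x, f b (strans A ab x) = f a x) ->
  forall a (x : A a), smap f (sinj x) = f a x.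
Proof.
move=> fc a x; have : sinj (tagged (repr (sinj x))) = sinj x.
  by rewrite /sinj; case: (repr _) (reprK (sinj x)).
by move=> /sinjP[c [h1 [h2 e]]]; rewrite /smap -(fc _ _ h1) e fc.
Qed.

Definition sadd2 a (x : A a) b (y : A b) : seqlim :=
  sinj (strans A (leq_maxl a b) x + strans A (leq_maxr a b) y).

Lemma sadd2E a b c (ac : (a <= c)%N) (bc : (b <= c)%N) (x : A a) (y : A b) :
  sadd2 x y = sinj (strans A ac x + strans A bc y).
Proof.
have mc : (maxn a b <= c)%N by rewrite geq_max ac.
by rewrite /sadd2 -(sinj_trans mc) linearD (strans_comp _ _ ac) (strans_comp _ _ bc).
Qed.

Definition sadd (x y : seqlim) : seqlim :=
  smap (fun a x' => smap (fun b y' => sadd2 x' y') y) x.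
Definition sscale (c : K) (x : seqlim) : seqlim :=
  smap (fun a x' => sinj (c *: x')) x.
Definition sopp (x : seqlim) : seqlim := smap (fun a x' => sinj (- x')) x.
Definition szero : seqlim := sinj (0 : A 0%N).

Lemma sadd_inj a (x y : A a) : sadd (sinj x) (sinj y) = sinj (x + y).
Proof.
have compat2 b (x' : A b) a' b' (ab : (a' <= b')%N) (z : A a') :
    sadd2 x' (strans A ab z) = sadd2 x' z.
  have h := leq_maxl b b'; have h' := leq_maxr b b'.
  rewrite (sadd2E h h') (sadd2E h (leq_trans ab h')).
  by rewrite (strans_comp _ _ (leq_trans ab h')).
rewrite /sadd smap_inj => [|b b' ab z].
  by rewrite smap_inj // (sadd2E (leqnn a) (leqnn a)) !strans_id.
rewrite !smap_inj //.
have h := leq_maxl b' a; have h' := leq_maxr b' a.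
rewrite (sadd2E h h') (sadd2E (leq_trans ab h) h').
by rewrite (strans_comp _ _ (leq_trans ab h)).
Qed.

Lemma sscale_inj c a (x : A a) : sscale c (sinj x) = sinj (c *: x).
Proof.
rewrite /sscale smap_inj // => b b' ab z.
by rewrite -linearZ sinj_trans.
Qed.

Lemma sopp_inj a (x : A a) : sopp (sinj x) = sinj (- x).
Proof.
by rewrite /sopp smap_inj // => b b' ab z; rewrite -linearN sinj_trans.
Qed.

Lemma szero_inj a : szero = sinj (0 : A a).
Proof. by rewrite /szero -(sinj_trans (leq0n a)) linear0. Qed.

Lemma sinj_common2 (x y : seqlim) :
  exists a (x' y' : A a), x = sinj x' /\ y = sinj y'.
Proof.
have [a [x' ->]] := sinj_surj x; have [b [y' ->]] := sinj_surj y.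
exists (maxn a b), (strans A (leq_maxl a b) x'), (strans A (leq_maxr a b) y').
by rewrite !sinj_trans.
Qed.

Lemma sinj_common3 (x y z : seqlim) :
  exists a (x' y' z' : A a), [/\ x = sinj x', y = sinj y' & z = sinj z'].
Proof.
have [a [x' [y' [-> ->]]]] := sinj_common2 x y.
have [b [z' ->]] := sinj_surj z.
exists (maxn a b), (strans A (leq_maxl a b) x'), (strans A (leq_maxl a b) y').
by exists (strans A (leq_maxr a b) z'); rewrite !sinj_trans.
Qed.

Lemma saddA : associative sadd.
Proof.
move=> x y z; have [a [x' [y' [z' [-> -> ->]]]]] := sinj_common3 x y z.
by rewrite !sadd_inj addrA.
Qed.

Lemma saddC : commutative sadd.
Proof.
move=> x y; have [a [x' [y' [-> ->]]]] := sinj_common2 x y.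
by rewrite !sadd_inj addrC.
Qed.

Lemma sadd0 : left_id szero sadd.
Proof.
move=> x; have [a [x' ->]] := sinj_surj x.
by rewrite (szero_inj a) sadd_inj add0r.
Qed.

Lemma saddN : left_inverse szero sopp sadd.
Proof.
move=> x; have [a [x' ->]] := sinj_surj x.
by rewrite sopp_inj (szero_inj a) sadd_inj addNr.
Qed.

HB.instance Definition _ :=
  GRing.isZmodule.Build seqlim saddA saddC sadd0 saddN.

Lemma sinjD a (x y : A a) : sinj x + sinj y = sinj (x + y).
Proof. exact: sadd_inj. Qed.

Lemma sscaleA c d x : sscale c (sscale d x) = sscale (c * d) x.
Proof.
by have [a [x' ->]] := sinj_surj x; rewrite !sscale_inj scalerA.
Qed.

Lemma sscale1 : left_id 1 sscale.
Proof.
by move=> x; have [a [x' ->]] := sinj_surj x; rewrite sscale_inj scale1r.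
Qed.

Lemma sscaleDr : right_distributive sscale +%R.
Proof.
move=> c x y; have [a [x' [y' [-> ->]]]] := sinj_common2 x y.
by rewrite sinjD !sscale_inj sinjD scalerDr.
Qed.

Lemma sscaleDl x : {morph sscale^~ x : c d / c + d}.
Proof.
move=> c d; have [a [x' ->]] := sinj_surj x.
by rewrite !sscale_inj sinjD scalerDl.
Qed.

HB.instance Definition _ := GRing.Zmodule_isLmodule.Build K seqlim
  sscaleA sscale1 sscaleDr sscaleDl.

Lemma sinj_is_linear a : linear (@sinj a).
Proof. by move=> c x y; rewrite -sinjD -sscale_inj. Qed.
HB.instance Definition _ a :=
  GRing.isLinear.Build K (A a) seqlim *:%R (@sinj a) (@sinj_is_linear a).

End Seqlim.

Definition posnat : Type := {n : nat | (0 < n)%N}.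

Section DirectLimit.
Context {k : fieldType} (U : ultrafilter posnat).
Local Notation K := (upower U k).

(** The ultraproduct of the categories [RepP k n m] over all [n > 0]: as [U] is
    nonprincipal, the finitely many components with [n <= m] are irrelevant,
    and this is the ultraproduct over [n > m]. *)
Definition uRepP (m : nat) : lincat K :=
  ultraproduct U (fun n : posnat => RepP k (sval n) m).

Definition unat m : uRepP m := fun n => nat_rep k (sval n) m.
Definition utriv m : uRepP m := fun n => triv_rep k (sval n) m.
Definition uzerorep m : uRepP m := fun n => zero_rep k (sval n) m.
Definition udual m (X : uRepP m) : uRepP m := fun n => dual_rep (X n).
Definition utens m (X Y : uRepP m) : uRepP m := fun n => tens_rep (X n) (Y n).
Definition udsum m (X Y : uRepP m) : uRepP m := fun n => dsum_rep (X n) (Y n).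

(** The tensor product of the factors [V[m]] (for [true]) and [V[m]^*] (for
    [false]) listed in [w]. *)
Definition mixed_tensor m (w : seq bool) : uRepP m :=
  foldr (fun b => @utens m (if b then unat m else udual (unat m))) (utriv m) w.

Definition mixed_sum m (s : seq (seq bool)) : uRepP m :=
  foldr (fun w => @udsum m (mixed_tensor m w)) (uzerorep m) s.

Definition generated m (X : uRepP m) : Prop :=
  exists s, is_subquotient X (mixed_sum m s).

(** Rep P_(t,m), for the element t of the ultrapower with germ n |-> n: the
    tensor subcategory of [uRepP m] generated by [unat m]. *)
Definition RepPt (m : nat) : lincat K := full_subcat (@generated m).

Lemma ucomp_germ m (X Y Z : uRepP m)
    (g : forall n, equivar m (Y n) (Z n)) (f : forall n, equivar m (X n) (Y n)) :
  comp (germ U g : mor Y Z) (germ U f : mor X Y) =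
  germ U (fun n => equivar_comp (g n) (f n)).
Proof. exact: umap2_germ. Qed.

Lemma umonoP m (X Y : uRepP m) (f : forall n, equivar m (X n) (Y n)) :
  is_mono (germ U f : mor X Y) <->
  uset U [set n | row_free (emx (f n))^T]%classic.
Proof.
split=> [fm|fm Z g h].
  pose i n := ker_incl (f n).
  pose W : uRepP m := fun n => ker_rep (f n).
  have : (germ U i : mor W X) = 0.
    apply: fm; rewrite germ0 !ucomp_germ; apply/germP; apply: filterE => n /=.
    by rewrite ker_inclK; apply: val_inj; rewrite /= mulmx0.
  by move/germP; apply: filterS => n /= /ker_incl_eq0.
rewrite -(ureprK g) -(ureprK h) !ucomp_germ => /germP gh; apply/germP.
apply: filterS2 fm gh => n /= fn /(congr1 (fun F => (emx F)^T)) /=.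
rewrite !trmx_mul => /(row_free_inj fn) /trmx_inj e.
exact: val_inj.
Qed.

Lemma uepiP m (X Y : uRepP m) (f : forall n, equivar m (X n) (Y n)) :
  is_epi (germ U f : mor X Y) <->
  uset U [set n | row_free (emx (f n))]%classic.
Proof.
split=> [fe|fe Z g h].
  pose q n := coker_proj (f n).
  pose W : uRepP m := fun n => coker_rep (f n).
  have : (germ U q : mor Y W) = 0.
    apply: fe; rewrite germ0 !ucomp_germ; apply/germP; apply: filterE => n /=.
    by rewrite coker_projK; apply: val_inj; rewrite /= mul0mx.
  by move/germP; apply: filterS => n /= /coker_proj_eq0.
rewrite -(ureprK g) -(ureprK h) !ucomp_germ => /germP gh; apply/germP.
apply: filterS2 fe gh => n /= fn /(congr1 (fun F => emx F)) /=.
by move=> /(row_free_inj fn) e; exact: val_inj.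
Qed.

(** The underlying sequence of an object of [uRepP m]. Morphism spaces only
    depend on the underlying sequences, which restriction does not change. *)
Definition useq : Type := forall n : posnat, @prerep k (sval n).

Definition under m (X : uRepP m) : useq := fun n => X n.

Definition ghom (l : nat) (X Y : useq) : lmodType K :=
  uprod U (fun n => equivar l (X n) (Y n)).

Definition gcomp l (X Y Z : useq) : ghom l Y Z -> ghom l X Y -> ghom l X Z :=
  umap2 (fun n => @equivar_comp k (sval n) l (X n) (Y n) (Z n)).

Definition gid l (X : useq) : ghom l X X := germ U (fun n => equivar_id l (X n)).

Definition gres l l' (ll' : (l <= l')%N) (X Y : useq) :
    {linear ghom l X Y -> ghom l' X Y} :=
  @ulin posnat U k (fun n => equivar l (X n) (Y n))
    (fun n => equivar l' (X n) (Y n))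
    (fun n => @res_equivar k (sval n) l l' ll' (X n) (Y n)).

Lemma gcomp_germ l (X Y Z : useq) (g : forall n, equivar l (Y n) (Z n))
    (f : forall n, equivar l (X n) (Y n)) :
  gcomp (germ U g : ghom l Y Z) (germ U f : ghom l X Y) =
  germ U (fun n => equivar_comp (g n) (f n)).
Proof. exact: umap2_germ. Qed.

Lemma gres_germ l l' (ll' : (l <= l')%N) (X Y : useq)
    (f : forall n, equivar l (X n) (Y n)) :
  gres ll' X Y (germ U f) = germ U (fun n => res_equivar ll' (f n)).
Proof. exact: ulin_germ. Qed.

Lemma gres_id l (ll : (l <= l)%N) (X Y : useq) (f : ghom l X Y) :
  gres ll X Y f = f.
Proof.
rewrite -(ureprK f) gres_germ; apply/germP.
by apply: filterE => n /=; apply: val_inj.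
Qed.

Lemma gres_gres l1 l2 l3 (l12 : (l1 <= l2)%N) (l23 : (l2 <= l3)%N)
    (l13 : (l1 <= l3)%N) (X Y : useq) (f : ghom l1 X Y) :
  gres l23 X Y (gres l12 X Y f) = gres l13 X Y f.
Proof.
have [f' ->] := germ_surj f; rewrite (gres_germ l13) (gres_germ l12).
rewrite gres_germ; apply/germP.
by apply: filterE => n /=; apply: val_inj.
Qed.

Lemma gres_comp l l' (ll' : (l <= l')%N) (X Y Z : useq)
    (g : ghom l Y Z) (f : ghom l X Y) :
  gres ll' X Z (gcomp g f) = gcomp (gres ll' Y Z g) (gres ll' X Y f).
Proof.
have [f' ->] := germ_surj f; have [g' ->] := germ_surj g.
rewrite gcomp_germ (gres_germ ll' g') (gres_germ ll' f').
rewrite (gres_germ ll' (fun n => equivar_comp (g' n) (f' n))) gcomp_germ.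
by apply/germP; apply: filterE => n /=; apply: val_inj.
Qed.

Lemma gres_gid l l' (ll' : (l <= l')%N) (X : useq) :
  gres ll' X X (gid l X) = gid l' X.
Proof.
rewrite /gid gres_germ; apply/germP.
by apply: filterE => n /=; apply: val_inj.
Qed.

Lemma gcomp1m l (X Y : useq) (f : ghom l X Y) : gcomp (gid l Y) f = f.
Proof.
rewrite -(ureprK f) gcomp_germ; apply/germP.
by apply: filterE => n /=; apply: val_inj; rewrite /= mul1mx.
Qed.

Lemma gcompm1 l (X Y : useq) (f : ghom l X Y) : gcomp f (gid l X) = f.
Proof.
rewrite -(ureprK f) gcomp_germ; apply/germP.
by apply: filterE => n /=; apply: val_inj; rewrite /= mulmx1.
Qed.

Lemma gcompA l (X Y Z T : useq) (h : ghom l Z T) (g : ghom l Y Z)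
    (f : ghom l X Y) : gcomp h (gcomp g f) = gcomp (gcomp h g) f.
Proof.
have [f' ->] := germ_surj f; have [g' ->] := germ_surj g.
have [h' ->] := germ_surj h; rewrite (gcomp_germ g' f') (gcomp_germ h' g').
rewrite (gcomp_germ h' (fun n => equivar_comp (g' n) (f' n))).
rewrite (gcomp_germ (fun n => equivar_comp (h' n) (g' n)) f'); apply/germP.
by apply: filterE => n /=; apply: val_inj; rewrite /= mulmxA.
Qed.

Lemma gcomp_linearl l (X Y Z : useq) (f : ghom l X Y) :
  linear (fun g : ghom l Y Z => gcomp g f).
Proof.
move=> c g h; rewrite -(upower_reprK c); move: (upower_repr c) => c'.
have [f' ->] := germ_surj f; have [g' ->] := germ_surj g.
have [h' ->] := germ_surj h; rewrite (gcomp_germ g' f') (gcomp_germ h' f').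
rewrite !germZ !germD (gcomp_germ (fun n => c' n *: g' n + h' n) f').
apply/germP.
by apply: filterE => n /=; apply: val_inj; rewrite /= mulmxDl -scalemxAl.
Qed.

Lemma gcomp_linearr l (X Y Z : useq) (g : ghom l Y Z) :
  linear (fun f : ghom l X Y => gcomp g f).
Proof.
move=> c f h; rewrite -(upower_reprK c); move: (upower_repr c) => c'.
have [f' ->] := germ_surj f; have [g' ->] := germ_surj g.
have [h' ->] := germ_surj h; rewrite (gcomp_germ g' f') (gcomp_germ g' h').
rewrite !germZ !germD (gcomp_germ g' (fun n => c' n *: f' n + h' n)).
apply/germP.
by apply: filterE => n /=; apply: val_inj; rewrite /= mulmxDr -scalemxAr.
Qed.

Section Restriction.
Variables (m l : nat) (ml : (m <= l)%N).

Definition ures (X : uRepP m) : uRepP l := fun n => res_rep ml (X n).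

Definition ures_hom (X Y : uRepP m) : {linear mor X Y -> mor (ures X) (ures Y)} :=
  gres ml (fun n => X n) (fun n => Y n).

Lemma ures_germ (X Y : uRepP m) (f : forall n, equivar m (X n) (Y n)) :
  ures_hom X Y (germ U f) = germ U (fun n => res_equivar ml (f n)).
Proof. exact: gres_germ. Qed.

Lemma ures_id X : ures_hom X X (idm X) = idm (ures X).
Proof.
by rewrite ures_germ; apply/germP; apply: filterE => n /=; apply: val_inj.
Qed.

Lemma ures_comp X Y Z (g : mor Y Z) (f : mor X Y) :
  ures_hom X Z (comp g f) = comp (ures_hom Y Z g) (ures_hom X Y f).
Proof.
rewrite -(ureprK g) -(ureprK f) ucomp_germ !ures_germ ucomp_germ.
by apply/germP; apply: filterE => n /=; apply: val_inj.
Qed.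

Lemma ures_mono (X Y : uRepP m) (f : mor X Y) :
  is_mono f -> is_mono (ures_hom X Y f).
Proof. by rewrite -(ureprK f) => /umonoP fm; rewrite ures_germ; apply/umonoP. Qed.

Lemma ures_epi (X Y : uRepP m) (f : mor X Y) :
  is_epi f -> is_epi (ures_hom X Y f).
Proof. by rewrite -(ureprK f) => /uepiP fm; rewrite ures_germ; apply/uepiP. Qed.

Lemma rep_eq n a (X Y : @rep k n a) : rep_pre X = rep_pre Y -> X = Y.
Proof.
by case: X Y => X XP [Y YP] /= e; case: Y / e YP => YP; congr Rep.
Qed.

Lemma ures_mixed_tensor w : ures (mixed_tensor m w) = mixed_tensor l w.
Proof.
elim: w => [|b w IH] /=.
  by apply: functional_extensionality_dep => n; exact: rep_eq.
rewrite -IH; apply: functional_extensionality_dep => n; apply: rep_eq.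
by case: b.
Qed.

Lemma ures_mixed_sum s : ures (mixed_sum m s) = mixed_sum l s.
Proof.
elim: s => [|w s IH] /=.
  by apply: functional_extensionality_dep => n; exact: rep_eq.
rewrite -IH -ures_mixed_tensor.
by apply: functional_extensionality_dep => n; exact: rep_eq.
Qed.

Lemma generated_res X : generated X -> generated (ures X).
Proof.
move=> [s [S [i [p [im pe]]]]]; exists s; rewrite -ures_mixed_sum.
exists (ures S), (ures_hom S _ i), (ures_hom S X p).
by split; [exact: ures_mono | exact: ures_epi].
Qed.

Definition res_ob (X : RepPt m) : RepPt l :=
  exist _ (ures (sval X)) (generated_res (svalP X)).

Definition resP : linfunctor (RepPt m) (RepPt l) :=
  @LinFunctor K (RepPt m) (RepPt l) res_ob
    (fun X Y => ures_hom (sval X) (sval Y))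
    (fun X => ures_id (sval X)) (fun X Y Z => @ures_comp _ _ _).

End Restriction.

Definition Ct_ob : Type := {m : nat & RepPt m}.
Implicit Types X Y Z T : Ct_ob.

Definition Ct_under X : useq := under (sval (tagged X)).

(** The morphisms from [X] to [Y] after restriction to [RepPt l], where
    [tag X <= l] and [tag Y <= l]; see [hom_atE], [hom_upE] and [comp_atE]. *)
Definition hom_at l X Y : lmodType K := ghom l (Ct_under X) (Ct_under Y).

Definition hom_up l l' (ll' : (l <= l')%N) X Y :
  {linear hom_at l X Y -> hom_at l' X Y} := gres ll' (Ct_under X) (Ct_under Y).
Arguments hom_up l l' ll' {X Y}.

Definition comp_at l X Y Z (g : hom_at l Y Z) (f : hom_at l X Y) :
  hom_at l X Z := gcomp g f.

Lemma hom_atE l X Y (Xl : (tag X <= l)%N) (Yl : (tag Y <= l)%N) :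
  mor (resP Xl (tagged X)) (resP Yl (tagged Y)) = hom_at l X Y.
Proof. by []. Qed.

Lemma hom_upE l l' (ll' : (l <= l')%N) X Y (Xl : (tag X <= l)%N)
    (Yl : (tag Y <= l)%N)
    (f : mor (resP Xl (tagged X)) (resP Yl (tagged Y))) :
  fhom (resP ll') f = hom_up l l' ll' (f : hom_at l X Y) :> hom_at l' X Y.
Proof. by []. Qed.

Lemma comp_atE l X Y Z (Xl : (tag X <= l)%N) (Yl : (tag Y <= l)%N)
    (Zl : (tag Z <= l)%N)
    (g : mor (resP Yl (tagged Y)) (resP Zl (tagged Z)))
    (f : mor (resP Xl (tagged X)) (resP Yl (tagged Y))) :
  comp g f = comp_at (g : hom_at l Y Z) (f : hom_at l X Y) :> hom_at l X Z.
Proof. by []. Qed.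

Definition level X Y (a : nat) : nat := (maxn (tag X) (tag Y) + a)%N.

Lemma level_mono X Y a b : (a <= b)%N -> (level X Y a <= level X Y b)%N.
Proof. by rewrite leq_add2l. Qed.

Lemma leq_level X Y l : (l <= level X Y l)%N.
Proof. exact: leq_addl. Qed.

Definition Ct_sys X Y : seqsys K := @Seqsys K
  (fun a => hom_at (level X Y a) X Y)
  (fun a b ab => hom_up _ _ (level_mono X Y ab))
  (fun a aa => @gres_id _ (level_mono X Y aa) _ _)
  (fun a b c ab bc ac =>
     @gres_gres _ _ _ (level_mono X Y ab) (level_mono X Y bc)
       (level_mono X Y ac) _ _).

Definition Ct_hom X Y : lmodType K := seqlim (Ct_sys X Y).

Definition Ct_cls l X Y (f : hom_at l X Y) : Ct_hom X Y :=
  @sinj K (Ct_sys X Y) l (hom_up l _ (leq_level X Y l) f).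

Lemma Ct_cls_up l l' (ll' : (l <= l')%N) X Y (f : hom_at l X Y) :
  Ct_cls (hom_up l l' ll' f) = Ct_cls f.
Proof.
rewrite /Ct_cls -[RHS](sinj_trans ll'); congr sinj.
have h := leq_trans (leq_level X Y l) (level_mono X Y ll').
by rewrite /= (gres_gres _ _ h) [RHS](gres_gres _ _ h).
Qed.

Lemma Ct_cls_sinj X Y a (f : Ct_sys X Y a) :
  Ct_cls (f : hom_at (level X Y a) X Y) = sinj f.
Proof.
rewrite /Ct_cls -[RHS](sinj_trans (leq_level X Y a)); congr sinj.
have h := leq_level X Y (level X Y a).
by rewrite -[LHS](gres_id (leqnn _)) -[RHS](gres_id (leqnn _)) /=
  (gres_gres _ _ h) (gres_gres _ _ h).
Qed.

Lemma Ct_cls_is_linear l X Y : linear (@Ct_cls l X Y).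
Proof. by move=> c f g; rewrite /Ct_cls !linearP. Qed.

Lemma Ct_cls_surj X Y (z : Ct_hom X Y) : exists l0, forall l, (l0 <= l)%N ->
  exists f : hom_at l X Y, z = Ct_cls f.
Proof.
have [a [f ->]] := sinj_surj z.
exists (level X Y a) => l al.
exists (hom_up _ l al (f : hom_at (level X Y a) X Y)).
by rewrite Ct_cls_up Ct_cls_sinj.
Qed.

Definition Ct_id X : Ct_hom X X := Ct_cls (gid (tag X) (Ct_under X)).

Lemma Ct_idE l X : (tag X <= l)%N -> Ct_id X = Ct_cls (gid l (Ct_under X)).
Proof.
by move=> Xl; rewrite /Ct_id -(Ct_cls_up Xl); congr Ct_cls; exact: gres_gid.
Qed.

Definition Ct_comp2 X Y Z l1 (g : hom_at l1 Y Z) l2 (f : hom_at l2 X Y) :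
  Ct_hom X Z :=
  Ct_cls (comp_at (hom_up l1 _ (leq_maxl l1 l2) g)
                  (hom_up l2 _ (leq_maxr l1 l2) f)).

Lemma Ct_comp2E X Y Z l1 (g : hom_at l1 Y Z) l2 (f : hom_at l2 X Y) l
    (l1l : (l1 <= l)%N) (l2l : (l2 <= l)%N) :
  Ct_comp2 g f = Ct_cls (comp_at (hom_up l1 l l1l g) (hom_up l2 l l2l f)).
Proof.
have ml : (maxn l1 l2 <= l)%N by rewrite geq_max l1l.
rewrite /Ct_comp2 -(Ct_cls_up ml) /hom_up /comp_at gres_comp.
by rewrite (gres_gres _ _ l1l) (gres_gres _ _ l2l).
Qed.

Lemma Ct_comp2_upl X Y Z l1 l1' (h : (l1 <= l1')%N) (g : hom_at l1 Y Z)
    l2 (f : hom_at l2 X Y) :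
  Ct_comp2 (hom_up l1 l1' h g) f = Ct_comp2 g f.
Proof.
have h1 := leq_maxl l1' l2; have h2 := leq_maxr l1' l2.
rewrite (Ct_comp2E _ _ h1 h2) (Ct_comp2E _ _ (leq_trans h h1) h2).
by rewrite /hom_up (gres_gres _ _ (leq_trans h h1)).
Qed.

Lemma Ct_comp2_upr X Y Z l1 (g : hom_at l1 Y Z) l2 l2' (h : (l2 <= l2')%N)
    (f : hom_at l2 X Y) :
  Ct_comp2 g (hom_up l2 l2' h f) = Ct_comp2 g f.
Proof.
have h1 := leq_maxl l1 l2'; have h2 := leq_maxr l1 l2'.
rewrite (Ct_comp2E _ _ h1 h2) (Ct_comp2E _ _ h1 (leq_trans h h2)).
by rewrite /hom_up (gres_gres _ _ (leq_trans h h2)).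
Qed.

Definition Ct_comp X Y Z (z : Ct_hom Y Z) (w : Ct_hom X Y) : Ct_hom X Z :=
  smap (fun a (g : Ct_sys Y Z a) => smap (fun b (f : Ct_sys X Y b) =>
    Ct_comp2 (g : hom_at (level Y Z a) Y Z) (f : hom_at (level X Y b) X Y))
    w) z.

Lemma Ct_comp_sinj X Y Z a b (g : Ct_sys Y Z a) (f : Ct_sys X Y b) :
  Ct_comp (sinj g) (sinj f) =
  Ct_comp2 (g : hom_at (level Y Z a) Y Z) (f : hom_at (level X Y b) X Y).
Proof.
rewrite /Ct_comp smap_inj => [|a1 a2 h x].
  by rewrite smap_inj // => b1 b2 h y; exact: Ct_comp2_upr.
rewrite !smap_inj => [|b1 b2 h' y|b1 b2 h' y]; [|exact: Ct_comp2_upr..].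
exact: Ct_comp2_upl.
Qed.

Lemma Ct_comp_cls l X Y Z (g : hom_at l Y Z) (f : hom_at l X Y) :
  Ct_comp (Ct_cls g) (Ct_cls f) = Ct_cls (comp_at g f).
Proof.
rewrite Ct_comp_sinj Ct_comp2_upl Ct_comp2_upr (Ct_comp2E _ _ (leqnn l) (leqnn l)).
by rewrite /hom_up !gres_id.
Qed.

Lemma Ct_common2 X Y (x y : Ct_hom X Y) : exists l0, forall l, (l0 <= l)%N ->
  exists f g : hom_at l X Y, x = Ct_cls f /\ y = Ct_cls g.
Proof.
have [a aP] := Ct_cls_surj x; have [b bP] := Ct_cls_surj y.
exists (maxn a b) => l; rewrite geq_max => /andP[al bl].
by have [f ->] := aP _ al; have [g ->] := bP _ bl; exists f, g.
Qed.

(** The direct limit of the categories [RepPt m] along the functors [resP]: an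
    object is an object of some [RepPt m], and morphism spaces are the direct
    limits over [l] of the spaces of morphisms between restrictions to
    [RepPt l]. *)
Definition Ct : lincat K.
Proof.
refine (@LinCat K Ct_ob Ct_hom Ct_id Ct_comp _ _ _ _ _).
- move=> X Y z; have [a aP] := Ct_cls_surj z.
  have [f ->] := aP _ (leq_maxl a (tag Y)).
  by rewrite (Ct_idE (leq_maxr a (tag Y))) Ct_comp_cls /comp_at gcomp1m.
- move=> X Y z; have [a aP] := Ct_cls_surj z.
  have [f ->] := aP _ (leq_maxl a (tag X)).
  by rewrite (Ct_idE (leq_maxr a (tag X))) Ct_comp_cls /comp_at gcompm1.
- move=> X Y Z T h g f.
  have [a aP] := Ct_cls_surj h; have [b bP] := Ct_cls_surj g.
  have [c cP] := Ct_cls_surj f; pose l := (a + b + c)%N.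
  have [h' ->] : exists h', h = Ct_cls (h' : hom_at l Z T).
    by apply: aP; rewrite /l; lia.
  have [g' ->] : exists g', g = Ct_cls (g' : hom_at l Y Z).
    by apply: bP; rewrite /l; lia.
  have [f' ->] : exists f', f = Ct_cls (f' : hom_at l X Y).
    by apply: cP; rewrite /l; lia.
  by rewrite !Ct_comp_cls /comp_at gcompA.
- move=> X Y Z f c g h.
  have [a aP] := Ct_common2 g h; have [b bP] := Ct_cls_surj f.
  have [g' [h' [-> ->]]] := aP _ (leq_maxl a b).
  have [f' ->] := bP _ (leq_maxr a b).
  by rewrite -Ct_cls_is_linear !Ct_comp_cls /comp_at gcomp_linearl -Ct_cls_is_linear.
- move=> X Y Z g c f h.
  have [a aP] := Ct_common2 f h; have [b bP] := Ct_cls_surj g.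
  have [f' [h' [-> ->]]] := aP _ (leq_maxl a b).
  have [g' ->] := bP _ (leq_maxr a b).
  by rewrite -Ct_cls_is_linear !Ct_comp_cls /comp_at gcomp_linearr -Ct_cls_is_linear.
Defined.

End DirectLimit.
Arguments Ct k U : clear implicits.

(* Main.v *)
(** Finite-dimensionality. A map between rational representations of [P_(n,m)]
    that is equivariant for a smaller [P_(n,l)] is already equivariant for
    [P_(n,m)], since [P_(n,m) / P_(n,l)] is projective; so the direct limit
    creates no new morphisms. At level [m], the symmetric group [S_(n-m)]
    embedded in [P_(n,m)] permutes the basis of a mixed tensor space, and by
    Maschke averaging a subquotient of such a space is a direct summand for
    [S_(n-m)]. Hence [Hom(X, Y)] embeds into the [S_(n-m)]-equivariant maps
    between two permutation modules, whose dimension is the number of orbits on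
    pairs of basis vectors, bounded independently of [n].

    Infinite length. An object of finite length is zero or has a simple
    subobject. The natural object [V] has none: a nonzero subobject of [V]
    living at level [l] contains the span of the first [n - l] basis vectors,
    hence acquires at level [l + 1] the proper nonzero subobject spanned by the
    first [n - l - 1] of them. *)

From HB Require Import structures.
Require Import Defs.
From mathcomp Require Import all_boot all_algebra fingroup perm.
From mathcomp Require Import boolp classical_sets filter.
From mathcomp Require Import mxtens zify.

Set Implicit Arguments.
Unset Strict Implicit.
Unset Printing Implicit Defensive.

Import GRing.Theory.
Local Open Scope ring_scope.

(** * Restriction to smaller parabolic subgroups *)

Section Stabilisation.
Variable k : fieldType.
Hypothesis k_char0 : [pchar k] =i pred0.

Lemma natr_inj_char0 : injective (fun n : nat => n%:R : k).
Proof.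
suff inj a b : (a <= b)%N -> a%:R = b%:R :> k -> a = b.
  by move=> a b; case: (leqP a b) => [/inj|/ltnW/inj h /esym/h].
move=> ab /eqP; rewrite eq_sym -subr_eq0 -natrB //.
by rewrite (proj1 (pcharf0P k) k_char0); lia.
Qed.

(** In characteristic 0 the scalars 1, 2, ... are distinct and nonzero, which gives [p - q] more
    roots than its degree allows. *)
Lemma poly_eq_nonzero (p q : {poly k}) :
  (forall c, c != 0 -> p.[c] = q.[c]) -> p = q.
Proof.
move=> pq; apply/eqP; rewrite -subr_eq0; apply/negP => /negP d0.
pose s := [seq i.+1%:R : k | i <- iota 0 (size (p - q))].
have su : uniq s.
  by rewrite map_inj_uniq ?iota_uniq // => a b /natr_inj_char0[].
have sr : all (root (p - q)) s.
  apply/allP => _ /mapP[i _ ->]; rewrite rootE !hornerE pq ?subrr //.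
  by rewrite (proj1 (pcharf0P k) k_char0).
by have := max_poly_roots d0 sr su; rewrite size_map size_iota ltnn.
Qed.

(** With [d = size q], multiplying [q.[c^-1]] by [c^d] gives a polynomial of degree at most [d]. It
    equals [p * 'X^d], so [p] is constant: a function regular at 0 and at infinity. *)
Lemma poly_inv_const (p q : {poly k}) :
  (forall c, c != 0 -> p.[c] = q.[c^-1]) -> forall c, p.[c] = p.[0].
Proof.
move=> pq; pose d := size q.
pose r := \poly_(i < d.+1) q`_(d - i).
have pr : p * 'X^d = r.
  apply: poly_eq_nonzero => c c0; rewrite !hornerE pq // horner_poly.
  rewrite horner_coef mulr_suml.
  rewrite [RHS](reindex_inj rev_ord_inj) /= big_ord_recr /=.
  rewrite subSS subnn subn0 nth_default // mul0r addr0.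
  apply: eq_bigr => i _; have id : (i <= d)%N by rewrite ltnW.
  by rewrite subSS subKn // -mulrA exprVn exprB ?unitfE // [_^-1 * _]mulrC.
have p1 : (size p <= 1)%N.
  have [->|p0] := eqVneq p 0; first by rewrite size_poly0.
  have : (size (p * 'X^d)%R <= d.+1)%N by rewrite pr size_poly.
  rewrite size_mul ?expf_neq0 ?polyX_eq0 // size_polyXn addnS /=.
  by rewrite -addn1 addnC leq_add2l.
by move=> c; rewrite (size1_polyC p1) !hornerC.
Qed.

Definition elem_mx n (i j : 'I_n) (c : k) : 'M[k]_n :=
  1%:M + c *: delta_mx i j.

Lemma elem_mxE n (i j a b : 'I_n) c :
  elem_mx i j c a b = (a == b)%:R + c * ((a == i) && (b == j))%:R.
Proof. by rewrite !mxE. Qed.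

Lemma elem_mx0 n (i j : 'I_n) : elem_mx i j 0 = 1%:M.
Proof. by rewrite /elem_mx scale0r addr0. Qed.

Lemma elem_mxM n (i j : 'I_n) c d : i != j ->
  elem_mx i j c *m elem_mx i j d = elem_mx i j (c + d).
Proof.
move=> ij; rewrite /elem_mx mulmxDl !mulmxDr !mul1mx mulmx1.
rewrite -scalemxAl -scalemxAr mul_delta_mx_0 1?eq_sym // !scaler0 addr0.
by rewrite scalerDl -addrA [c *: _ + _]addrC.
Qed.

Lemma det_elem_mx n (i j : 'I_n) c : i != j -> \det (elem_mx i j c) = 1.
Proof.
have diag (a b : 'I_n) : a != b -> \prod_l elem_mx a b c l l = 1.
  move=> ab; rewrite big1 // => l _; rewrite elem_mxE eqxx.
  by case: eqP => [->|]; rewrite ?(negPf ab) mulr0 addr0.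
have trig (a b : 'I_n) : (b < a)%N -> \det (elem_mx a b c) = 1.
  move=> ba; rewrite det_trig ?diag //; first by rewrite -val_eqE /=; lia.
  apply/is_trig_mxP => x y xy; rewrite elem_mxE.
  rewrite -!val_eqE /=; have -> : (x == y :> nat) = false by lia.
  have -> : (x == a :> nat) && (y == b :> nat) = false by lia.
  by rewrite mulr0 addr0.
rewrite -val_eqE neq_ltn => /orP[ij|]; last exact: trig.
rewrite -det_tr; have -> : (elem_mx i j c)^T = elem_mx j i c.
  by apply/matrixP => a b; rewrite mxE !elem_mxE eq_sym andbC.
exact: trig.
Qed.

(** The inverse determinant contributes no denominator, since these elementary matrices have
    determinant 1. *)
Lemma regular_elem_mx n (f : 'M[k]_n -> k) (i j : 'I_n) : i != j ->
  regular f -> exists p : {poly k}, forall c, f (elem_mx i j c) = p.[c].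
Proof.
move=> ij; elim=> [c|a b||f1 f2 _ [p1 e1] _ [p2 e2]|f1 f2 _ [p1 e1] _ [p2 e2]].
- by exists c%:P => d; rewrite hornerC.
- exists ((a == b)%:R%:P + 'X * ((a == i) && (b == j))%:R%:P) => c.
  by rewrite elem_mxE !hornerE.
- by exists 1 => c; rewrite det_elem_mx // hornerE invr1.
- by exists (p1 + p2) => c; rewrite hornerE e1 e2.
- by exists (p1 * p2) => c; rewrite hornerE e1 e2.
Qed.

Lemma rational_elem_mx n l (X : @prerep k n) (i j : 'I_n) : i != j ->
  is_rational l X -> (forall c, elem_mx i j c \in parab l) ->
  exists P : 'M[{poly k}]_(rdim X),
    forall c a b, ract X (elem_mx i j c) a b = (P a b).[c].
Proof.
move=> ij Xrat ijP.
have pex (ab : 'I_(rdim X) * 'I_(rdim X)) : exists p : {poly k},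
    forall c, ract X (elem_mx i j c) ab.1 ab.2 = p.[c].
  have [f fr fE] := rat_regular Xrat ab.1 ab.2.
  have [p pE] := regular_elem_mx ij fr.
  by exists p => c; rewrite fE // pE.
have [P PE] := choice pex.
exists (\matrix_(a, b) P (a, b)) => c a b.
by rewrite mxE -PE.
Qed.

Lemma elem_mx_parab n l (i j : 'I_n) c : i != j -> (blk l i <= blk l j)%N ->
  elem_mx i j c \in parab l.
Proof.
move=> ij bij; apply/parabP; split.
  by rewrite unitmxE det_elem_mx // unitr1.
move=> a b ba; rewrite elem_mxE; case: eqP ba => [->|_]; first by rewrite ltnn.
case: andP => [[/eqP-> /eqP->]|_]; last by rewrite mulr0 addr0.
by rewrite ltnNge bij.
Qed.

Lemma rational_orbit_poly n l (X Y : @prerep k n) (i j : 'I_n)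
    (A : 'M[k]_(rdim Y, rdim X)) :
  i != j -> is_rational l X -> is_rational l Y ->
  (forall c, elem_mx i j c \in parab l) ->
  exists P : 'M[{poly k}]_(rdim Y, rdim X), forall c a b,
    (ract Y (elem_mx i j c) *m A *m ract X (elem_mx i j (- c))) a b =
    (P a b).[c].
Proof.
move=> ij Xrat Yrat ijP.
have [P PE] := rational_elem_mx ij Yrat ijP.
have [Q QE] := rational_elem_mx ij Xrat ijP.
exists (P *m map_mx polyC A *m map_mx (fun p => p \Po - 'X) Q) => c a b.
rewrite !mxE horner_sum; apply: eq_bigr => v _.
rewrite hornerM !mxE horner_sum horner_comp !hornerE -QE.
congr (_ * _); apply: eq_bigr => u _.
by rewrite hornerM !mxE hornerC PE.
Qed.

Section Step.
Variables (n l : nat) (X Y : @prerep k n).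
Hypotheses (Xrat : is_rational l X) (Yrat : is_rational l Y).
Variable F : 'M[k]_(rdim Y, rdim X).
Hypothesis FP : F \in @equivariant k n l.+1 X Y.

(** [H] is stable under products and under cancelling a right factor. So it is enough to reduce an
    element of [parab l] to [parab l.+1] by factors from [parab l.+1] and from lower root subgroups
    of the first block. *)
Let H g := (g \in parab l) /\ F *m ract X g = ract Y g *m F.

Let HM g h : H g -> H h -> H (g *m h).
Proof.
move=> [gP ge] [hP he]; split; first exact: parabM.
by rewrite (ratM Xrat) // (ratM Yrat) // mulmxA ge -!mulmxA he.
Qed.

Let HP g : g \in parab l.+1 -> H g.
Proof.
by move=> gP; split; [exact: parab_sub gP | move/equivariantP: FP; apply].
Qed.

Let HMl g h : H h -> g \in parab l -> H (g *m h) -> H g.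
Proof.
move=> [hP he] gP [ghP]; rewrite (ratM Xrat) // (ratM Yrat) // mulmxA => ghe.
split=> //.
have hV : ract X h *m ract X (invmx h) = 1%:M.
  by rewrite -(ratM Xrat) ?parabV // (mulmxV (parab_unit hP)) (Defs.rat1 Xrat).
move/(congr1 (fun A => A *m ract X (invmx h))): ghe.
by rewrite -!mulmxA hV mulmx1 [ract Y h *m _]mulmxA -he -mulmxA hV mulmx1.
Qed.

(** The orbit map of [F] on the lower root subgroup is polynomial in [c]; as
    [1 + c E_ji = (1 + c^-1 E_ij) w b] with [b] upper triangular, it is also
    polynomial in [c^-1], hence constant. *)
Let H_lower (i j : 'I_n) c : (i < j)%N -> (j < n - l)%N -> H (elem_mx j i c).
Proof.
move=> ij jN.
have nij : i != j by rewrite -val_eqE neq_ltn ij.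
have nji : j != i by rewrite eq_sym.
have bij : blk l i = blk l j by rewrite /blk; lia.
have xP d : elem_mx i j d \in parab l by apply: elem_mx_parab; rewrite ?bij.
have yP d : elem_mx j i d \in parab l by apply: elem_mx_parab; rewrite ?bij.
pose w : 'M[k]_n := perm_mx (tperm i j).
have ww : w *m w = 1%:M by rewrite /w -perm_mxM tperm2 perm_mx1.
have wP : w \in parab l.
  apply/parabP; split; first exact: unitmx_perm.
  move=> a b ba; rewrite !mxE; case: eqP => // e.
  by move: ba; rewrite -e; case: tpermP => [->|->|]; rewrite ?bij ltnn.
(* On the coordinates [i], [j] the product of the two elementary matrices is [[[0, -1/d], [d, 1]]];
   [w] exchanges its rows, which gives the upper triangular [[[d, 1], [0, -1/d]]]. *)
pose b d := w *m (elem_mx i j (- d^-1) *m elem_mx j i d).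
have bP d : d != 0 -> b d \in parab l.+1.
  move=> d0; apply/parabP; split.
    by rewrite !unitmx_mul unitmx_perm !unitmxE !det_elem_mx // unitr1.
  have M : elem_mx i j (- d^-1) *m elem_mx j i d =
      1%:M + d *: delta_mx j i - d^-1 *: delta_mx i j - delta_mx i i.
    rewrite {1}/elem_mx mulmxDl mul1mx -scalemxAl mulmxDr mulmx1.
    rewrite -scalemxAr mul_delta_mx scalerDr scalerA mulNr mulVf // scaleN1r.
    by rewrite scaleNr addrA.
  move=> x y yx; have {yx} yx : (y < x)%N by move: yx; rewrite /blk; lia.
  rewrite /b M -row_permE !mxE.
  have ne (a a' : 'I_n) : (a < a')%N -> (a == a') = false /\ (a' == a) = false.
    by rewrite -!val_eqE /=; lia.
  have [nij1 nji1] := ne _ _ ij; have [nxy nyx] := ne _ _ yx.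
  case: tpermP => [xi|xj|/eqP/negPf xi /eqP/negPf xj].
  - rewrite xi in yx; have [niy nyi] := ne _ _ yx.
    have [njy nyj] := ne _ _ (ltn_trans yx ij).
    by rewrite nyj nji1 niy !andbF !mulr0 !subr0 addr0.
  - rewrite xj in nxy; rewrite nij1 nxy eqxx [y == i]eq_sym.
    by rewrite !mulr0 addr0 subr0 subrr.
  - by rewrite xi xj nyx !mulr0 !subr0 addr0.
pose Phi d := ract Y (elem_mx j i d) *m F *m ract X (elem_mx j i (- d)).
have ract1 (Z : prerep n) d : is_rational l Z ->
    ract Z (elem_mx j i (- d)) *m ract Z (elem_mx j i d) = 1%:M.
  by move=> Zrat; rewrite -(ratM Zrat) // elem_mxM // addNr elem_mx0 (Defs.rat1 Zrat).
(* As [H (b d)] holds, [b d] can be moved across [F]; this rewrites the orbit map of [F] at [d] as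
   that of the [w]-conjugate of [F] at [d^-1]. *)
have PhiE d : d != 0 -> Phi d = ract Y (elem_mx i j d^-1) *m
    (ract Y w *m F *m ract X w) *m ract X (elem_mx i j (- d^-1)).
  move=> d0; have [bl be] := HP (bP d d0).
  have yb : elem_mx j i d = elem_mx i j d^-1 *m (w *m b d).
    by rewrite /b !mulmxA -(mulmxA _ w w) ww mulmx1 elem_mxM // subrr elem_mx0 mul1mx.
  have by' : b d *m elem_mx j i (- d) = w *m elem_mx i j (- d^-1).
    by rewrite /b -!mulmxA elem_mxM // subrr elem_mx0 mulmx1.
  rewrite /Phi {1}yb (ratM Yrat) ?parabM // (ratM Yrat) //.
  rewrite -!mulmxA [ract Y (b d) *m _]mulmxA -be -mulmxA -(ratM Xrat) //.
  by rewrite by' (ratM Xrat).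
have [P PE] := rational_orbit_poly F nji Xrat Yrat yP.
have [Q QE] := rational_orbit_poly (ract Y w *m F *m ract X w) nij Xrat Yrat xP.
have PhiF d : Phi d = F.
  apply/matrixP => a b'; rewrite [LHS]PE (@poly_inv_const _ (Q a b')) => [|e e0].
    by rewrite -PE oppr0 elem_mx0 (Defs.rat1 Xrat) (Defs.rat1 Yrat) mul1mx mulmx1.
  by rewrite -PE -QE -PhiE.
split=> //; rewrite -{1}(PhiF c) /Phi -mulmxA ract1 // mulmx1.
by [].
Qed.

(** Gaussian elimination in row [r]: right multiplication by [elem_mx r i c] adds [c] times column
    [r] to column [i], so the pivot [g r r] clears the columns to its left one after another. *)
Let clear_row (r : 'I_n) (g : 'M[k]_n) t : r.+1 = (n - l)%N ->
  g \in parab l -> g r r != 0 -> (t <= r)%N ->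
  exists h, [/\ H h, forall i : 'I_n, (i < t)%N -> (g *m h) r i = 0 &
    (g *m h) r r = g r r].
Proof.
move=> rN gP grr; elim: t => [|t IH] tr.
  by exists 1%:M; split=> [|i|]; rewrite ?mulmx1 //; apply: HP; exact: parab1.
have [h [hH h0 hr]] := IH (ltnW tr).
have tn : (t < n)%N by rewrite (ltn_trans tr).
pose i := Ordinal tn; have ir : r != i by rewrite -val_eqE /=; lia.
pose c := - ((g *m h) r i / g r r).
have E (a : 'I_n) : (g *m (h *m elem_mx r i c)) r a =
    (g *m h) r a + c * g r r * (a == i)%:R.
  rewrite mulmxA /elem_mx mulmxDr mulmx1 -scalemxAr !mxE; congr (_ + _).
  rewrite -mulrA; congr (c * _).
  rewrite (bigD1 r) //= big1 => [|b /negPf br]; last by rewrite !mxE br mulr0.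
  by rewrite addr0 hr mxE eqxx.
exists (h *m elem_mx r i c); split.
- by apply: HM => //; apply: H_lower; rewrite /=; lia.
- move=> a; rewrite ltnS leq_eqVlt E => /orP[/eqP ai|ai].
    have -> : a = i by apply: val_inj.
    by rewrite eqxx mulr1 /c mulNr divfK // subrr.
  rewrite h0 // (_ : (a == i) = false) ?mulr0 ?addr0 //.
  by rewrite -val_eqE /=; lia.
- by rewrite E (negPf ir) mulr0 addr0.
Qed.

(** After clearing, the product lies in [parab l.+1], because [r] is the only row on which that
    group has more prescribed zeros than [parab l]. *)
Let H_diag (r : 'I_n) (g : 'M[k]_n) : r.+1 = (n - l)%N ->
  g \in parab l -> g r r != 0 -> H g.
Proof.
move=> rN gP grr; have [h [hH h0 _]] := clear_row rN gP grr (leqnn r).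
apply: (HMl hH gP); apply: HP.
have [hP _] := hH; have /parabP[ghu gh0] := parabM gP hP.
apply/parabP; split=> // a b ba.
have [ar|ar] := eqVneq a r.
  by rewrite ar; apply: h0; move: ba; rewrite /blk ar; lia.
by apply: gh0; move: ba ar; rewrite -val_eqE /blk /=; lia.
Qed.

Lemma equivariant_step : F \in @equivariant k n l X Y.
Proof.
apply/equivariantP => g gP; suff: H g by case.
(* For [n <= l] all blocks have size 1, and [parab l] and [parab l.+1] coincide. *)
have [N0|N0] := leqP (n - l) 0.
  apply: HP; move/parabP: gP => [gu g0]; apply/parabP; split=> // a b ba.
  by apply: g0; move: ba; rewrite /blk; lia.
have rn : ((n - l).-1 < n)%N by lia.
pose r := Ordinal rn; have rN : r.+1 = (n - l)%N by rewrite /=; lia.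
have [g0|] := eqVneq (g r r) 0; last exact: H_diag.
(* Column [r] of [invmx g] vanishes below the first block, so [g *m invmx g = 1] forces a nonzero
   entry of row [r] within that block. *)
have [b bN gb] : exists2 b : 'I_n, (b < n - l)%N & g r b != 0.
  have e : \sum_b g r b * invmx g b r = 1.
    by have /matrixP/(_ r r) := mulmxV (parab_unit gP); rewrite !mxE eqxx.
  apply: contrapT => nb; have /eqP[] := oner_neq0 k; rewrite -e.
  apply: big1 => b _; have [bN|Nb] := ltnP b (n - l).
    by have [->|gb] := eqVneq (g r b) 0; rewrite ?mul0r //; case: nb; exists b.
  have /parabP[_ ->] := parabV gP; rewrite ?mulr0 //.
  by rewrite /blk; lia.
have br : b != r by apply: contra_neq gb => ->.
(* Adding column [b] to column [r] makes [g r b] the new pivot; as [b < r], an upper triangular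
   matrix does this. *)
have xP : elem_mx b r 1 \in parab l.+1.
  by apply: elem_mx_parab => //; move: br; rewrite /blk -val_eqE /=; lia.
have xH := HP xP; have [xP' _] := xH.
apply: (HMl xH gP); apply: (H_diag rN); first exact: parabM.
rewrite /elem_mx scale1r mulmxDr mulmx1 !mxE g0 add0r.
rewrite (bigD1 b) //= big1 => [|a /negPf ab]; last by rewrite !mxE ab mulr0.
by rewrite addr0 mxE !eqxx mulr1.
Qed.

End Step.

Lemma equivariant_stable n l l' (X Y : @prerep k n) :
  is_rational l X -> is_rational l Y -> (l <= l')%N ->
  {subset @equivariant k n l' X Y <= @equivariant k n l X Y}.
Proof.
move=> Xrat Yrat ll' F; elim: l' ll' => [|l' IH].
  by rewrite leqn0 => /eqP->.
rewrite leq_eqVlt => /orP[/eqP->//|ll' FP]; apply: IH => //.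
apply: equivariant_step FP; [exact: (res_rational (Rep Xrat))|].
exact: (res_rational (Rep Yrat)).
Qed.

End Stabilisation.

(** * Permutation modules *)

Section PermutationModules.
Variable k : fieldType.

Definition perm_act n (s : 'S_n) (c : nat * seq 'I_n) : nat * seq 'I_n :=
  (c.1, map s c.2).

Lemma perm_act_inj n (s : 'S_n) : injective (perm_act s).
Proof.
by move=> [t u] [t' u'] [-> /(inj_map perm_inj) ->].
Qed.

Lemma invmx_perm n (s : 'S_n) : invmx (perm_mx s) = perm_mx s^-1%g :> 'M[k]_n.
Proof.
apply: (can_inj (mulKmx (unitmx_perm k s))).
by rewrite mulmxV ?unitmx_perm // -perm_mxM mulgV perm_mx1.
Qed.

(** [c] labels the basis of [X] so that permutation matrices permute the basis
    as they permute the labels; the first component of a label names a summand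
    and the second one lists the tensor factors. *)
Record perm_coded n (X : @prerep k n) (c : 'I_(rdim X) -> nat * seq 'I_n) :
    Prop := PermCoded {
  code_inj : injective c;
  code_act : forall (s : 'S_n) i, exists j, c j = perm_act s (c i);
  code_ract : forall (s : 'S_n) i j,
    ract X (perm_mx s) i j = (perm_act s (c i) == c j)%:R
}.

Lemma triv_coded n :
  perm_coded (X := triv_prerep n) (fun _ => (0%N, [::])).
Proof.
split=> [i j _|s i|s i j]; first by rewrite !ord1.
- by exists i.
- by rewrite !ord1 mxE.
Qed.

Lemma nat_coded n : perm_coded (X := nat_prerep n) (fun i => (0%N, [:: i])).
Proof.
split=> [i j [//]|s i|s i j]; first by exists (s i).
by rewrite /= !mxE /perm_act /= xpair_eqE /= eqseq_cons andbT.
Qed.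

(** Permutation matrices are orthogonal, so the dual basis is permuted by the same rule and keeps
    its labels. *)
Lemma dual_coded n (X : @prerep k n) (c : 'I_(rdim X) -> nat * seq 'I_n) :
  perm_coded c -> perm_coded (X := dual_prerep X) c.
Proof.
move=> [ci ca cr]; split=> // s i j.
rewrite /= mxE invmx_perm cr -(inj_eq (@perm_act_inj _ s)); congr (_%:R).
rewrite /perm_act /= -map_comp (eq_map (g := id)) ?map_id => [|a /=].
  by rewrite eq_sym; case: (c j).
by rewrite permKV.
Qed.

(** Labels are concatenated; the common length [r] in the first factor makes the cut recoverable,
    hence the labelling injective. *)
Lemma tens_coded n (X Y : @prerep k n) r cX cY :
  perm_coded cX -> perm_coded cY ->
  (forall i, (cX i).1 = 0%N /\ size (cX i).2 = r) ->
  (forall i, (cY i).1 = 0%N) ->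
  perm_coded (X := tens_prerep X Y) (fun i =>
    (0%N, (cX (mxtens_unindex i).1).2 ++ (cY (mxtens_unindex i).2).2)).
Proof.
move=> [cXi cXa cXr] [cYi cYa cYr] cX0 cY0; split.
- move=> i j /(congr1 snd) e; move: e; case: (mxtens_indexP i) => i1 i2.
  case: (mxtens_indexP j) => j1 j2; rewrite !mxtens_indexK /= => /eqP.
  rewrite eqseq_cat; last by rewrite !(cX0 _).2.
  move=> /andP[/eqP e1 /eqP e2]; congr (mxtens_index (_, _)).
    by apply: cXi; apply: injective_projections; rewrite ?(cX0 _).1.
  by apply: cYi; apply: injective_projections; rewrite ?cY0.
- move=> s i; case: (mxtens_indexP i) => i1 i2.
  have [j1 e1] := cXa s i1; have [j2 e2] := cYa s i2.
  exists (mxtens_index (j1, j2)); rewrite !mxtens_indexK /= e1 e2.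
  by rewrite /perm_act /= map_cat.
- move=> s i j; case: (mxtens_indexP i) => i1 i2.
  case: (mxtens_indexP j) => j1 j2; rewrite tensmxE !mxtens_indexK cXr cYr.
  rewrite -natrM mulnb; congr (nat_of_bool _)%:R.
  rewrite /perm_act !xpair_eqE /= map_cat eqseq_cat; last first.
    by rewrite size_map !(cX0 _).2.
  by rewrite -!pair_eqE /= /pair_eq /= !(cX0 _).1 !cY0 !eqxx.
Qed.

(** The name [t], larger than every name used for [Y], separates the new summand from the old
    ones. *)
Lemma dsum_coded n (X Y : @prerep k n) t cX cY :
  perm_coded cX -> perm_coded cY -> (forall i, (cX i).1 = 0%N) ->
  (forall i, (cY i).1 < t)%N ->
  perm_coded (X := dsum_prerep X Y) (fun i =>
    match split i with inl a => (t, (cX a).2) | inr b => cY b end).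
Proof.
move=> [cXi cXa cXr] [cYi cYa cYr] cX0 cYt.
have sl a : split (lshift (rdim Y) a) = inl a := unsplitK (inl a).
have sr b : split (rshift (rdim X) b) = inr b := unsplitK (inr b).
have act1 (s : 'S_n) x : (perm_act s x).1 = x.1 by [].
have tY (x : seq 'I_n) b : ((t, x) == cY b) = false.
  by apply/eqP => e; have := cYt b; rewrite -e ltnn.
split.
- move=> i j; case: (split_ordP i) => a ->; case: (split_ordP j) => b ->;
    rewrite ?sl ?sr => e.
  + congr lshift; apply: cXi; apply: injective_projections.
      by rewrite !cX0.
    by case: e.
  + by have := tY (cX a).2 b; rewrite e eqxx.
  + by have := tY (cX b).2 a; rewrite e eqxx.
  + by congr rshift; apply: cYi.
- move=> s i; case: (split_ordP i) => a _.
    by have [j e] := cXa s a; exists (lshift _ j); rewrite sl e.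
  by have [j e] := cYa s a; exists (rshift _ j); rewrite sr e.
- move=> s i j; case: (split_ordP i) => a ->; case: (split_ordP j) => b ->;
    rewrite ?sl ?sr /=.
  + by rewrite block_mxEul cXr -!pair_eqE /= /pair_eq /= !cX0 !eqxx.
  + by rewrite block_mxEur mxE tY.
  + rewrite block_mxEdl mxE (_ : (_ == _) = false) //.
    by apply/eqP => e; have := cYt a; rewrite -(act1 s) e ltnn.
  + by rewrite block_mxEdr cYr.
Qed.

Variables (U : ultrafilter posnat) (m : nat).

Lemma mixed_tensor_coded (w : seq bool) n :
  exists c, perm_coded (X := @mixed_tensor k U m w n) c /\
    forall i, (c i).1 = 0%N /\ size (c i).2 = size w.
Proof.
elim: w => [|b w [c [cP c0]]].
  by exists (fun=> (0%N, [::])); split=> //; exact: triv_coded.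
have [d [dP d0]] : exists d, perm_coded
      (X := (if b then unat U m else udual (unat U m)) n : @prerep k (sval n)) d
    /\ forall i, (d i).1 = 0%N /\ size (d i).2 = 1%N.
  case: b; exists (fun i : 'I_(sval n) => (0%N, [:: i])); split=> //.
    exact: nat_coded.
  exact: dual_coded (nat_coded _).
eexists; split.
  by apply: (tens_coded dP cP d0) => i; rewrite (c0 i).1.
by move=> i; rewrite /= size_cat (c0 _).2 (d0 _).2.
Qed.

(** The bounds on names and lengths depend on [s] alone, so they are uniform in [n]. *)
Lemma mixed_sum_coded (s : seq (seq bool)) n :
  exists c, perm_coded (X := @mixed_sum k U m s n) c /\
    forall i, ((c i).1 < size s)%N /\ (size (c i).2 <= \max_(w <- s) size w)%N.
Proof.
elim: s => [|w s [c [cP c0]]].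
  have no (i : 'I_0) : False by case: i.
  exists (fun=> (0%N, [::])); split; last by move=> [].
  by split=> [i|? i|? i]; case: (no i).
have [d [dP d0]] := mixed_tensor_coded w n.
eexists; split.
  apply: (dsum_coded (t := size s) dP cP) => i; first by rewrite (d0 i).1.
  by case: (c0 i).
move=> i; rewrite big_cons; case: (split_ordP i) => a _ /=.
  by rewrite (d0 a).2 ltnSn leq_maxl.
have [h1 h2] := c0 a; split; first exact: ltnW.
by rewrite (leq_trans h2) // leq_maxr.
Qed.

End PermutationModules.

(** * Orbits of the symmetric group on pairs of labels *)

Section Orbits.
Variables (k : fieldType) (n m : nat).

(** The copy of the symmetric group on [n - m] letters that acts on the first block of [parab m]. *)
Definition top_perms : {set 'S_n} :=
  [set s : 'S_n | [forall a : 'I_n, (n - m <= a)%N ==> (s a == a)]]%SET.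

Lemma top_permsP (s : 'S_n) :
  reflect (forall a : 'I_n, (n - m <= a)%N -> s a = a) (s \in top_perms).
Proof.
rewrite inE; apply: (iffP forallP) => h a; first by move/(implyP (h a))/eqP.
by apply/implyP => /h ->.
Qed.

Lemma top_perms1 : 1%g \in top_perms.
Proof. by apply/top_permsP => a _; rewrite perm1. Qed.

Lemma top_permsM s t : s \in top_perms -> t \in top_perms ->
  (s * t)%g \in top_perms.
Proof.
move=> /top_permsP sP /top_permsP tP; apply/top_permsP => a aN.
by rewrite permM sP // tP.
Qed.

Lemma top_permsV s : s \in top_perms -> (s^-1)%g \in top_perms.
Proof.
by move=> /top_permsP sP; apply/top_permsP => a aN; rewrite -{1}(sP a aN) permK.
Qed.

Lemma top_perms_parab s : s \in top_perms -> perm_mx s \in @parab k n m.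
Proof.
move=> /top_permsP sP; apply/parabP; split; first exact: unitmx_perm.
move=> i j; rewrite !mxE /blk => ji; case: eqP => // e.
have [iN|Ni] := leqP (n - m) i.
  by move: ji; rewrite -e sP // ltnn.
by move: ji; lia.
Qed.

(** The entries can be moved into a set of at most [size u + m] indices, a bound
    that does not depend on [n]. *)
Lemma top_perms_move (u : seq 'I_n) : exists2 s, s \in top_perms &
  forall a, a \in u -> (s a < size u)%N || (n - m <= s a)%N.
Proof.
elim: u => [|x u [s sP su]]; first by exists 1%g => //; exact: top_perms1.
have [sx|sx] := boolP ((s x < (size u).+1)%N || (n - m <= s x)%N).
  exists s => // a; rewrite inE => /orP[/eqP->//|/su]; rewrite /=; lia.
have xn : (size u < n)%N by have := ltn_ord (s x); lia.
(* Position [size u] is not occupied by the entries moved so far, and both it and [s x] lie below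
   [n - m]; so the transposition stays in the group and disturbs none of those entries. *)
pose y := Ordinal xn; exists (s * tperm (s x) y)%g.
  apply: top_permsM => //; apply/top_permsP => a aN.
  by rewrite tpermD // -val_eqE /=; lia.
move=> a; rewrite inE permM => /orP[/eqP->|/su sa].
  by rewrite tpermL /= ltnSn.
case: tpermP => [e|e|_ _] /=; last by lia.
  by rewrite ltnSn.
by move: sa sx; rewrite e /=; lia.
Qed.

Variables (X Y : @prerep k n) (cX : 'I_(rdim X) -> nat * seq 'I_n)
  (cY : 'I_(rdim Y) -> nat * seq 'I_n).
Hypotheses (cXP : perm_coded cX) (cYP : perm_coded cY).

Definition top_equivariant (A B : @prerep k n) (F : 'M[k]_(rdim B, rdim A)) :=
  forall s, s \in top_perms ->
    F *m ract A (perm_mx s) = ract B (perm_mx s) *m F.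

(** At the entry [(i, j')], a single term survives on each side of the equivariance identity. *)
Lemma top_equivariant_orbit (F : 'M[k]_(rdim Y, rdim X)) s i j i' j' :
  top_equivariant F -> s \in top_perms ->
  cY i' = perm_act s (cY i) -> cX j' = perm_act s (cX j) -> F i' j' = F i j.
Proof.
move=> FP sP ei ej; have /matrixP/(_ i j') := FP s sP; rewrite !mxE.
rewrite (bigD1 j) //= (code_ract cXP) ej eqxx mulr1.
rewrite big1 => [|l lj]; last first.
  rewrite (code_ract cXP) ej (inj_eq (@perm_act_inj _ s)) (inj_eq (code_inj cXP)).
  by rewrite (negPf lj) mulr0.
rewrite (bigD1 i') //= (code_ract cYP) ei eqxx mul1r.
rewrite big1 => [|l lj]; last first.
  rewrite (code_ract cYP) -ei (inj_eq (code_inj cYP)) eq_sym.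
  by rewrite (negPf lj) mul0r.
by rewrite !addr0.
Qed.

Variables (t r : nat).
Hypotheses (cX0 : forall i, ((cX i).1 < t)%N /\ (size (cX i).2 <= r)%N).
Hypotheses (cY0 : forall i, ((cY i).1 < t)%N /\ (size (cY i).2 <= r)%N).

(** A code stands for a label whose entries are below [r + r] or at least [n - m]; [r + r] bounds
    the length of two labels joined. The type does not depend on [n]. *)
Definition orbit_code : finType := ('I_t * r.-bseq 'I_(r + r + m))%type.

Definition decode_index (b : nat) : nat :=
  (if b < r + r then b else n - m + (b - (r + r)))%N.

Definition decode (p : orbit_code) : nat * seq nat :=
  (p.1 : nat, map decode_index (map val (p.2 : r.-bseq _))).

Definition val_code (c : nat * seq 'I_n) : nat * seq nat := (c.1, map val c.2).

Lemma val_code_inj : injective val_code.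
Proof. by move=> [a u] [b v] [-> /(inj_map val_inj) ->]. Qed.

Lemma decode_surj (c : nat * seq 'I_n) : (c.1 < t)%N -> (size c.2 <= r)%N ->
  (forall a, a \in c.2 -> (a < r + r)%N || (n - m <= a)%N) ->
  exists p, decode p = val_code c.
Proof.
case: c => a u /= at_ ur uP.
pose f (b : 'I_n) : nat := (if b < r + r then b : nat else r + r + (b - (n - m)))%N.
have fP b : b \in u -> (f b < r + r + m)%N.
  by move=> /uP; rewrite /f; have := ltn_ord b; case: (ltnP b (r + r)) => /=; lia.
pose v := pmap (fun b => insub (f b) : option 'I_(r + r + m)) u.
have vu : map val v = map f u.
  rewrite /v; elim: u fP {uP ur v} => //= b u IH fP.
  rewrite insubT ?fP ?mem_head // => h /=; rewrite IH // => b' b'u.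
  by rewrite fP // inE b'u orbT.
have vr : (size v <= r)%N by rewrite -(size_map val) vu size_map.
exists (Ordinal at_, Bseq vr); rewrite /decode /val_code /=; congr (_, _).
rewrite vu -map_comp; apply/eq_in_map => b /uP /=.
rewrite /f /decode_index; case: (ltnP b (r + r)) => h /=; first by rewrite h.
by case: ltnP; lia.
Qed.

(** The entries of [F] at the coded pairs, which meet every orbit; 0 is a default for codes that
    name no basis vector. *)
Definition orbit_coord (F : 'M[k]_(rdim Y, rdim X)) :
    'rV[k]_#|{: orbit_code * orbit_code}| :=
  \row_p match [pick i | val_code (cY i) == decode (enum_val p).1],
               [pick j | val_code (cX j) == decode (enum_val p).2] with
         | Some i, Some j => F i j | _, _ => 0 end.

Lemma orbit_coord_is_linear : linear orbit_coord.
Proof.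
move=> c F G; apply/rowP => p; rewrite !mxE.
case: [pick i | _] => [i|]; last by rewrite mulr0 addr0.
by case: [pick j | _] => [j|]; rewrite ?mxE ?mulr0 ?addr0.
Qed.

(** A single permutation moves the entries of both labels into the coded range, and [F] keeps its
    value along the orbit. *)
Lemma orbit_coord_eq0 F : top_equivariant F -> orbit_coord F = 0 -> F = 0.
Proof.
move=> FP F0; apply/matrixP => i j.
have [s sP su] := top_perms_move ((cY i).2 ++ (cX j).2).
have [i' ei] := code_act cYP s i; have [j' ej] := code_act cXP s j.
rewrite -(top_equivariant_orbit FP sP ei ej) mxE.
have sz : (size ((cY i).2 ++ (cX j).2) <= r + r)%N.
  by rewrite size_cat leq_add // ?(cX0 j).2 ?(cY0 i).2.
have [p pE] : exists p, decode p = val_code (cY i').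
  apply: decode_surj; rewrite ei /= ?size_map ?(cY0 i).1 ?(cY0 i).2 //.
  move=> _ /mapP[a au ->]; have := su a; rewrite mem_cat au => /(_ isT).
  by lia.
have [q qE] : exists q, decode q = val_code (cX j').
  apply: decode_surj; rewrite ej /= ?size_map ?(cX0 j).1 ?(cX0 j).2 //.
  move=> _ /mapP[a au ->]; have := su a; rewrite mem_cat au orbT => /(_ isT).
  by lia.
have /rowP/(_ (enum_rank (p, q))) := F0; rewrite !mxE enum_rankK /= pE qE.
case: pickP => [x /eqP/val_code_inj/(code_inj cYP)->|/(_ i')]; last by rewrite eqxx.
by case: pickP => [y /eqP/val_code_inj/(code_inj cXP)->|/(_ j')]; last by rewrite eqxx.
Qed.

End Orbits.

(** * Maschke averaging *)

Section Averaging.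
Variables (k : fieldType) (n m : nat).
Hypothesis k_char0 : [pchar k] =i pred0.
Local Notation top := (top_perms n m).

Definition average (A B : @prerep k n) (L : 'M[k]_(rdim B, rdim A)) :
    'M[k]_(rdim B, rdim A) :=
  #|top|%:R^-1 *: \sum_(s in top)
    ract B (perm_mx s^-1) *m L *m ract A (perm_mx s).

Lemma ract_perm (A : @rep k n m) s t : s \in top -> t \in top ->
  ract A (perm_mx s) *m ract A (perm_mx t) = ract A (perm_mx (s * t)%g).
Proof.
by move=> sP tP; rewrite -(ratM (repP A)) ?top_perms_parab // perm_mxM.
Qed.

Lemma average_equivariant (A B : @rep k n m) (L : 'M[k]_(rdim B, rdim A)) :
  top_equivariant m (average L).
Proof.
move=> t tP; rewrite /average -scalemxAl -scalemxAr; congr (_ *: _).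
rewrite mulmx_suml mulmx_sumr [RHS](reindex_inj (mulIg t)) /=.
apply: eq_big => [s|s sP].
  apply/idP/idP => h; first exact: top_permsM.
  by rewrite -(mulgK t s) top_permsM ?top_permsV.
have stP : (s * t)%g \in top by exact: top_permsM.
rewrite !mulmxA ract_perm ?top_permsV // invMg mulKVg -(mulmxA _ _ (ract A _)).
by rewrite ract_perm.
Qed.

Lemma mul_average (A B C : @prerep k n) (G : 'M[k]_(rdim C, rdim B))
    (L : 'M[k]_(rdim B, rdim A)) :
  top_equivariant m G -> G *m average L = average (G *m L).
Proof.
move=> GP; rewrite /average -scalemxAr mulmx_sumr; congr (_ *: _).
by apply: eq_bigr => s sP; rewrite !mulmxA GP ?top_permsV.
Qed.

Lemma average_mul (A B C : @prerep k n) (L : 'M[k]_(rdim C, rdim B))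
    (G : 'M[k]_(rdim B, rdim A)) :
  top_equivariant m G -> average L *m G = average (L *m G).
Proof.
move=> GP; rewrite /average -scalemxAl mulmx_suml; congr (_ *: _).
by apply: eq_bigr => s sP; rewrite -!mulmxA GP.
Qed.

Lemma average1 (A : @rep k n m) : average (1%:M : 'M_(rdim A)) = 1%:M.
Proof.
have ne : #|top|%:R != 0 :> k.
  rewrite (proj1 (pcharf0P k) k_char0) -lt0n; apply/card_gt0P.
  by exists 1%g; exact: top_perms1.
rewrite /average (eq_bigr (fun=> 1%:M)) => [|s sP].
  by rewrite sumr_const -scaler_nat scalerA mulVf // scale1r.
by rewrite mulmx1 ract_perm ?top_permsV // mulVg perm_mx1 (Defs.rat1 (repP A)).
Qed.

Lemma equivar_top (A B : @prerep k n) (F : 'M[k]_(rdim B, rdim A)) :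
  F \in @equivariant k n m A B -> top_equivariant m F.
Proof. by move=> /equivariantP FP s /(@top_perms_parab k) /FP. Qed.

Lemma top_equivariant_mul (A B C : @prerep k n) (G : 'M[k]_(rdim C, rdim B))
    (F : 'M[k]_(rdim B, rdim A)) :
  top_equivariant m G -> top_equivariant m F -> top_equivariant m (G *m F).
Proof. by move=> GP FP s sP; rewrite -mulmxA FP // !mulmxA GP. Qed.

Definition rep_subquotient (X M : @rep k n m) : Prop :=
  exists (S : @rep k n m) (i : equivar m S M) (p : equivar m S X),
    row_free (emx i)^T /\ row_free (emx p).

(** A left inverse of [i] and a right inverse of [p] remain one-sided inverses after averaging,
    since [i] and [p] are equivariant and the average of the identity is the identity. *)
Lemma subquotient_summand (X M : @rep k n m) : rep_subquotient X M ->
  exists (E : 'M[k]_(rdim X, rdim M)) (J : 'M[k]_(rdim M, rdim X)),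
    [/\ top_equivariant m E, top_equivariant m J & E *m J = 1%:M].
Proof.
move=> [S [i [p [/row_freeP[L iL] /row_freeP[s ps]]]]].
have iP := equivar_top (emxP i); have pP := equivar_top (emxP p).
have Li : L^T *m emx i = 1%:M.
  by apply: trmx_inj; rewrite trmx_mul trmxK iL trmx1.
exists (emx p *m average L^T), (emx i *m average s); split.
- by apply: top_equivariant_mul => //; exact: (@average_equivariant M S).
- by apply: top_equivariant_mul => //; exact: (@average_equivariant X S).
- rewrite mulmxA -(mulmxA _ _ (emx i)) average_mul // Li average1 mulmx1.
  by rewrite mul_average // ps average1.
Qed.

End Averaging.

(** By [subquotient_summand], [F] is determined by [J' *m F *m E], a map of permutation modules. The
    bound [D] counts pairs of codes, hence can be chosen before [n]. *)
Lemma bounded_coordinates (k : fieldType) (U : ultrafilter posnat) m s s' :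
  [pchar k] =i pred0 ->
  exists D, forall n (X Y : @rep k (sval n) m),
    rep_subquotient X (mixed_sum U m s n) ->
    rep_subquotient Y (mixed_sum U m s' n) ->
    exists f : 'M[k]_(rdim Y, rdim X) -> 'rV[k]_D, linear f /\
      forall F, F \in @equivariant k (sval n) m X Y -> f F = 0 -> F = 0.
Proof.
move=> k_char0; pose t := (size s + size s')%N.
pose r := (\max_(w <- s) size w + \max_(w <- s') size w)%N.
exists #|{: orbit_code m t r * orbit_code m t r}| => n X Y XM YM.
have [E [J [EP JP EJ]]] := subquotient_summand k_char0 XM.
have [E' [J' [EP' JP' EJ']]] := subquotient_summand k_char0 YM.
have [c [cP c0]] := mixed_sum_coded k U m s n.
have [d [dP d0]] := mixed_sum_coded k U m s' n.
exists (fun F => orbit_coord m c d t r (J' *m F *m E)); split.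
  move=> a F G; rewrite mulmxDr mulmxDl -scalemxAr -scalemxAl.
  exact: orbit_coord_is_linear.
move=> F FP /(orbit_coord_eq0 cP dP) e.
have : J' *m F *m E = 0.
  apply: e => [i|i|].
  - by have [h1 h2] := c0 i; rewrite /t /r; split; lia.
  - by have [h1 h2] := d0 i; rewrite /t /r; split; lia.
  - by do 2?apply: top_equivariant_mul => //; exact: equivar_top.
move/(congr1 (fun G => E' *m G *m J)).
by rewrite !mulmxA EJ' mul1mx -mulmxA EJ mulmx1 mulmx0 mul0mx.
Qed.

(** * Linear dependence in ultraproducts and direct limits *)

Section LinearDependence.
Variable K : fieldType.
Implicit Types V : lmodType K.

(** This bounds the dimension by [D]. It concerns finitely many vectors at a time, so a uniform
    bound passes to ultraproducts and direct limits. *)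
Definition dependent_above D V : Prop := forall v : 'I_D.+1 -> V,
  exists c : 'I_D.+1 -> K, (exists i, c i != 0) /\ \sum_i c i *: v i = 0.

Lemma dependent_of_coords D V (f : V -> 'rV[K]_D) : linear f ->
  (forall x, f x = 0 -> x = 0) -> dependent_above D V.
Proof.
move=> fl f0 v; pose A := \matrix_i f (v i).
have : kermx A != 0.
  rewrite -mxrank_eq0 mxrank_ker subn_eq0 -ltnNge.
  exact: leq_ltn_trans (rank_leq_col _) _.
move=> /rowV0Pn[u /sub_kermxP uA u0]; exists (fun i => u 0 i); split.
  by apply/existsP; move: u0; apply: contraR; rewrite negb_exists => /forallP h;
    apply/eqP/rowP => i; have := h i; rewrite negbK mxE => /eqP.
apply: f0; rewrite -uA mulmx_sum_row.
pose fL : {linear V -> 'rV[K]_D} :=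
  HB.pack f (GRing.isLinear.Build K V 'rV[K]_D *:%R f fl).
rewrite -[f]/(fL : _ -> _) linear_sum; apply: eq_bigr => i _.
by rewrite linearZ /= rowK.
Qed.

(** No free family has [D.+1] members, so there is a size [d] at which free families stop; a free
    family of that size is a basis. *)
Lemma dependent_findim D V : dependent_above D V -> findim V.
Proof.
move=> dep.
pose P d := exists v : 'I_d -> V,
  forall c : 'rV[K]_d, \sum_i c 0 i *: v i = 0 -> c = 0.
have [d [[v vfree] nP]] : exists d, P d /\ ~ P d.+1.
  apply: contrapT => no.
  have Pall d : P d.
    elim: d => [|d IH]; last by apply: contrapT => nP; apply: no; exists d.
    by exists (fun=> 0) => c _; apply/rowP => -[].
  have [v vfree] := Pall D.+1; have [c [[i /eqP ci] c0]] := dep v.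
  case: ci; have /rowP/(_ i) : \row_i c i = 0 by
    apply: vfree; rewrite -[RHS]c0; apply: eq_bigr => j _; rewrite mxE.
  by rewrite !mxE.
have span x : exists c : 'rV[K]_d, x = \sum_i c 0 i *: v i.
  apply: contrapT => no; apply: nP.
  exists (fun i => if unlift ord_max i is Some j then v j else x) => c.
  rewrite (bigD1_ord ord_max) //= unlift_none.
  rewrite (eq_bigr (fun i => c 0 (lift ord_max i) *: v i)) => [e|i _]; last first.
    by rewrite liftK.
  have [c0|c0] := eqVneq (c 0 ord_max) 0.
    have /rowP h : \row_i c 0 (lift ord_max i) = 0.
      apply: vfree; rewrite -[RHS]e c0 scale0r add0r.
      by apply: eq_bigr => i _; rewrite mxE.
    apply/rowP => i; rewrite mxE; case: (unliftP ord_max i) => [j ->|->] //.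
    by have := h j; rewrite !mxE.
  case: no; exists (\row_i - ((c 0 ord_max)^-1 * c 0 (lift ord_max i))).
  apply: (scalerI c0); move/eqP: e; rewrite addr_eq0 => /eqP ->.
  rewrite scaler_sumr -sumrN; apply: eq_bigr => i _.
  by rewrite mxE scalerA mulrN mulVKf // scaleNr.
have [f fE] := choice span.
have vinj (c c' : 'rV[K]_d) :
    \sum_i c 0 i *: v i = \sum_i c' 0 i *: v i -> c = c'.
  move=> e; apply/eqP; rewrite -subr_eq0; apply/eqP/vfree.
  rewrite -[RHS](subrr (\sum_i c 0 i *: v i)) {2}e -sumrB.
  by apply: eq_bigr => i _; rewrite !mxE scalerBl.
have fl : linear f.
  move=> a x y; apply: vinj; rewrite -fE {1}(fE x) {1}(fE y) scaler_sumr -big_split.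
  by apply: eq_bigr => i _; rewrite !mxE /= scalerDl scalerA.
exists d; constructor; exists f => //.
exists (fun c : 'rV[K]_d => \sum_i c 0 i *: v i) => [x|c]; first by rewrite -fE.
by apply: vinj; rewrite -fE.
Qed.
End LinearDependence.

Lemma comp_zeror (K : fieldType) (C : lincat K) (X Y Z : C) (g : mor Y Z) :
  Defs.comp g (0 : mor X Y) = 0.
Proof.
have := comp_linearr g (-1) (0 : mor X Y) 0.
by rewrite scaler0 addr0 scaleN1r addNr.
Qed.

Section Ultraproducts.
Context {I : Type} (U : ultrafilter I) {k : fieldType}.

Lemma germ_sum (J : finType) (M : I -> lmodType k) (f : J -> forall i, M i) :
  \sum_j germ U (f j) = germ U (fun i => \sum_j f j i).
Proof.
elim: (index_enum J) => [|j s IH].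
  rewrite big_nil germ0; congr germ.
  by apply: functional_extensionality_dep => i; rewrite big_nil.
rewrite big_cons IH germD; congr germ.
by apply: functional_extensionality_dep => i; rewrite big_cons.
Qed.

(** The coefficients are germs of coefficients chosen in each component. If all these germs
    vanished, the finitely many sets where they vanish would share an index with the set in [dep],
    and there all coefficients of a nontrivial relation would be zero. *)
Lemma uprod_dependent D (M : I -> lmodType k) :
  uset U [set i | dependent_above D (M i)]%classic ->
  dependent_above D (uprod U M).
Proof.
move=> dep v.
have rel i : exists c : 'I_D.+1 -> k, dependent_above D (M i) ->
    (exists j, c j != 0) /\ \sum_j c j *: urepr (v j) i = 0.
  have [h|h] := pselect (dependent_above D (M i)); last by exists (fun=> 0).
  by have [c] := h (fun j => urepr (v j) i); exists c.
have [c cP] := choice rel.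
exists (fun j => upower_germ U (fun i => c i j)); split.
  apply: contrapT => no.
  have c0 j : uset U [set i | c i j = 0]%classic.
    apply/(@upower_germP _ U k (fun i => c i j) (fun=> 0)).
    by apply: contrapT => nz; apply: no; exists j; apply/eqP.
  have [i [/cP[[j /eqP cj] _] c0i]] :=
    filter_ex (filterI dep (filter_forall _ c0)).
  exact: cj (c0i j).
rewrite (eq_bigr (fun j => germ U (fun i => c i j *: urepr (v j) i))).
  rewrite germ_sum germ0; apply/germP.
  by apply: filterS dep => i /cP[].
by move=> j _; rewrite -germZ ureprK.
Qed.

Lemma nonprincipal_neq (i : I) : nonprincipal U -> uset U [set j | j <> i]%classic.
Proof.
move=> npU; have [Ui|] := in_ultra_setVsetC [set i]%classic (uset_ultra U).
  case: (npU i); apply/predeqP => A; rewrite principal_filterP; split=> [UA|Ai].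
    by have [j [-> ]] := filter_ex (filterI Ui UA).
  by apply: filterS Ui => j ->.
by apply: filterS => j.
Qed.

End Ultraproducts.

Lemma nonprincipal_gt (U : ultrafilter posnat) (b : nat) : nonprincipal U ->
  uset U [set n | (b < sval n)%N]%classic.
Proof.
move=> npU; elim: b => [|b IH]; first by apply: filterE => -[].
have h : uset U [set n | sval n <> b.+1]%classic.
  pose i : posnat := exist _ b.+1 (ltn0Sn b).
  by apply: filterS (nonprincipal_neq i npU) => n /= ni e; apply: ni; apply: val_inj.
by apply: filterS2 IH h => n /= n1 n2; rewrite ltn_neqAle n1 andbT; apply/eqP => /esym.
Qed.

(** * Morphism spaces of the direct limit *)

Section MorphismsInCt.
Variables (k : fieldType) (U : ultrafilter posnat).
Implicit Types X Y Z : Ct k U.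

Lemma gres_inj l l' (ll' : (l <= l')%N) (X Y : useq) :
  injective (@gres k U l l' ll' X Y).
Proof.
move=> f g; have [f' ->] := germ_surj f; have [g' ->] := germ_surj g.
rewrite !gres_germ => /germP e; apply/germP.
by apply: filterS e => n /= /(congr1 val) /= e; apply: val_inj.
Qed.

(** Restriction does not change matrices, so the transition maps are injective and each level embeds
    in the limit. *)
Lemma Ct_cls_inj l X Y : injective (@Ct_cls k U l X Y).
Proof.
move=> f g /sinjP[c [h1 [h2 e]]]; move: e.
by rewrite (bool_irrelevance h1 h2) => /gres_inj/gres_inj.
Qed.

Lemma Ct_cls_eq0 l X Y (f : hom_at l X Y) : Ct_cls f = 0 -> f = 0.
Proof.
move=> f0; apply: Ct_cls_inj; rewrite f0.
have := Ct_cls_is_linear (-1) (0 : hom_at l X Y) 0.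
by rewrite scaler0 addr0 scaleN1r addNr.
Qed.

Lemma hom_at_germ l X Y (f : hom_at l X Y) :
  exists F : forall n, equivar l (Ct_under X n) (Ct_under Y n), f = germ U F.
Proof. exact: germ_surj. Qed.

Lemma comp_at_germ l X Y Z
    (G : forall n, equivar l (Ct_under Y n) (Ct_under Z n))
    (F : forall n, equivar l (Ct_under X n) (Ct_under Y n)) :
  comp_at (germ U G : hom_at l Y Z) (germ U F : hom_at l X Y) =
  (germ U (fun n => equivar_comp (G n) (F n)) : hom_at l X Z).
Proof. exact: gcomp_germ. Qed.

Lemma generated_subquotient l (X : uRepP U l) : Defs.generated X -> exists s,
  uset U [set n | rep_subquotient (X n : @rep k (sval n) l)
                    (mixed_sum U l s n)]%classic.
Proof.
move=> [s [S [i [p [im pe]]]]]; exists s.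
have [i' ei] := germ_surj i; have [p' ep] := germ_surj p.
rewrite {}ei in im; rewrite {}ep in pe.
move/umonoP: im => im; move/uepiP: pe => pe.
by apply: filterS2 im pe => n i1 p1; exists (S n), (i' n), (p' n).
Qed.

Hypothesis k_char0 : [pchar k] =i pred0.

(** The bound is uniform in [l]: by [equivariant_stable] a map of level [l] is already equivariant
    at level [l0], where [bounded_coordinates] applies. *)
Lemma hom_at_dependent X Y : exists D, forall l, (maxn (tag X) (tag Y) <= l)%N ->
  dependent_above D (hom_at l X Y).
Proof.
set l0 := maxn _ _.
pose X0 := sval (res_ob (leq_maxl (tag X) (tag Y)) (tagged X)) : uRepP U l0.
pose Y0 := sval (res_ob (leq_maxr (tag X) (tag Y)) (tagged Y)) : uRepP U l0.
have [s Xs] : exists s, uset U [set n |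
    rep_subquotient (X0 n : @rep k (sval n) l0) (mixed_sum U l0 s n)]%classic.
  exact: generated_subquotient (svalP (res_ob _ (tagged X))).
have [s' Ys] : exists s', uset U [set n |
    rep_subquotient (Y0 n : @rep k (sval n) l0) (mixed_sum U l0 s' n)]%classic.
  exact: generated_subquotient (svalP (res_ob _ (tagged Y))).
have [D DP] := bounded_coordinates U l0 s s' k_char0.
exists D => l l0l; apply: uprod_dependent.
apply: filterS2 Xs Ys => n Xn Yn; have [f [fl f0]] := DP n _ _ Xn Yn.
apply: (@dependent_of_coords _ _ _ (fun F => f (emx F))) => [a F G|F F0].
  exact: fl.
apply: val_inj; apply: f0 F0.
apply: (equivariant_stable k_char0 _ _ l0l (emxP F)).
  exact: repP (X0 n).
exact: repP (Y0 n).
Qed.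

Lemma Ct_hom_findim X Y : findim (mor X Y).
Proof.
have [D DP] := hom_at_dependent X Y; apply: (@dependent_findim _ D) => v.
have [a aP] := choice (fun i => Ct_cls_surj (v i)).
(* All of the [D.+1] given morphisms are represented at this level. *)
pose l := maxn (maxn (tag X) (tag Y)) (\max_i a i).
have fex i : exists f : hom_at l X Y, v i = Ct_cls f.
  by apply: aP; rewrite leq_max (leq_bigmax i) orbT.
have [f fE] := choice fex.
have [c [c0 cf]] := DP l (leq_maxl _ _) f; exists c; split=> //.
pose cl : {linear hom_at l X Y -> Ct_hom X Y} := HB.pack (@Ct_cls k U l X Y)
  (GRing.isLinear.Build _ _ _ *:%R _ (@Ct_cls_is_linear k U l X Y)).
transitivity (cl (\sum_i c i *: f i)); last by rewrite cf linear0.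
by rewrite linear_sum; apply: eq_bigr => i _; rewrite linearZ fE.
Qed.

End MorphismsInCt.

(** * Infinite length *)

Section CategoryLemmas.
Variables (K : fieldType) (C : lincat K).
Implicit Types X Y Z : C.

Lemma is_mono_comp X Y Z (g : mor Y Z) (f : mor X Y) :
  is_mono g -> is_mono f -> is_mono (Defs.comp g f).
Proof. by move=> gm fm W a b; rewrite -!Defs.compA => /gm/fm. Qed.

Lemma is_epi_id X : is_epi (idm X).
Proof. by move=> W a b; rewrite !compm1. Qed.

Lemma finite_length_simple_sub X : finite_length X ->
  is_zero X \/ exists S (f : mor S X), is_simple S /\ is_mono f.
Proof.
elim=> {X} [X|Y X S i q im [qi qU] Ssimple _ [Y0|[T [f [Tsimple fm]]]]].
- by left.
- right; exists S; have i0 : i = 0 by rewrite -(compm1 i) Y0 comp_zeror.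
  (* As [i = 0], the identity of [X] factors through its cokernel [q]; the factor [u] is inverse to
     [q] and embeds the simple object [S] in [X]. *)
  have [u [uq _]] : exists! u : mor S X, Defs.comp u q = idm X.
    by apply: qU; rewrite i0 comp_zeror.
  have [w [_ wU]] := qU _ q qi.
  have qu : Defs.comp q u = idm S.
    by rewrite -(wU _ (comp1m q)); apply/esym/wU; rewrite -Defs.compA uq compm1.
  exists u; split=> // Z g h /(congr1 (fun a => Defs.comp q a)).
  by rewrite !Defs.compA qu !comp1m.
- by right; exists T, (Defs.comp i f); split=> //; exact: is_mono_comp.
Qed.

End CategoryLemmas.

(** * Invariant subspaces of the natural representation *)

Section NaturalRepresentation.
Variable k : fieldType.

Lemma left_inverse_row_free p q (A : 'M[k]_(p, q)) (L : 'M[k]_(q, p)) :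
  L *m A = 1%:M -> row_free A^T.
Proof.
by move=> LA; apply/row_freeP; exists L^T; rewrite -trmx_mul LA trmx1.
Qed.

(** The isomorphism from the natural representation to its tensor product with the unit, plus a zero
    summand: the shape in which [mixed_sum] presents it. *)
Definition nat_tensor_mx n : 'M[k]_(n * 1 + 0, n) :=
  col_mx (\matrix_(x, j) ((mxtens_unindex x).1 == j)%:R) 0.

Lemma nat_tensor_equivariant n m : nat_tensor_mx n \in @equivariant k n m
  (nat_prerep n)
  (dsum_prerep (tens_prerep (nat_prerep n) (triv_prerep n)) (zero_prerep n)).
Proof.
apply/equivariantP => g _; rewrite /= /nat_tensor_mx mul_col_mx mul_block_col.
rewrite !mul0mx !mulmx0 !addr0; congr col_mx; apply/matrixP => x j.
case: (mxtens_indexP x) => a b; rewrite !mxE (bigD1 a) // big1 => [|l la].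
  rewrite (bigD1 (mxtens_index (j, b))) // big1 => [|y yj].
    by rewrite tensmxE !mxE !mxtens_indexK !eqxx mulr1 mul1r mulr1.
  case: (mxtens_indexP y) yj => c d; rewrite tensmxE !mxE mxtens_indexK.
  rewrite (ord1 d) (ord1 b) /=; case: (eqVneq c j) => [->|_].
    by rewrite eqxx.
  by rewrite mulr0.
by rewrite mxE mxtens_indexK /= eq_sym (negPf la) mul0r.
Qed.

Lemma nat_tensor_free n : row_free (nat_tensor_mx n)^T.
Proof.
pose f (j : 'I_n) := lshift 0 (mxtens_index (j, ord0 : 'I_1)).
apply: (@left_inverse_row_free _ _ _ (rowsub f 1%:M)).
rewrite mul_rowsub_mx mul1mx; apply/matrixP => i j.
by rewrite mxE col_mxEu !mxE mxtens_indexK.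
Qed.

Definition flag_mx n q : 'M[k]_(n, q) := \matrix_(i, j) (i == j :> nat)%:R.

Definition flag_prerep n q : @prerep k n :=
  Prerep (fun g => (flag_mx n q)^T *m g *m flag_mx n q).

Lemma mul_flag_mx p n q (qn : (q <= n)%N) (A : 'M[k]_(p, n)) i j :
  (A *m flag_mx n q) i j = A i (widen_ord qn j).
Proof.
rewrite mxE (bigD1 (widen_ord qn j)) //= mxE eqxx mulr1 big1 ?addr0 // => l lj.
by rewrite mxE -[_ == _ :> nat]/(l == widen_ord qn j) (negPf lj) mulr0.
Qed.

Lemma flag_mxK n q : (q <= n)%N -> (flag_mx n q)^T *m flag_mx n q = 1%:M.
Proof.
move=> qn; apply/matrixP => i j.
by rewrite (mul_flag_mx qn) !mxE -[LHS]/((j == i)%:R) eq_sym.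
Qed.

(** The flag matrix times its transpose is the projection onto the span of the first [n - l] basis
    vectors, which [parab l] preserves. *)
Lemma flag_invariant n l g : g \in @parab k n l ->
  flag_mx n (n - l) *m ((flag_mx n (n - l))^T *m g *m flag_mx n (n - l)) =
  g *m flag_mx n (n - l).
Proof.
move=> /parabP[_ gP]; have qn := leq_subr l n; rewrite -mulmxA mulmxA.
apply/matrixP => i j; have [il|li] := ltnP i (n - l).
  rewrite mxE (bigD1 (widen_ord qn (Ordinal il))) //= big1 => [|a ai].
    rewrite addr0; have -> : widen_ord qn (Ordinal il) = i by exact: val_inj.
    rewrite mxE (bigD1 (Ordinal il)) //= big1 => [|a ai].
      by rewrite !mxE !eqxx !mulr1 addr0 mul1r.
    rewrite !mxE [_ == _](_ : _ = false) ?mul0r //.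
    by apply/negP => /eqP e; case/eqP: ai; apply: val_inj.
  rewrite mxE big1 ?mul0r // => b _; rewrite !mxE.
  case: eqP => [ib|]; last by rewrite mul0r.
  case: eqP => [ab|]; last by rewrite mulr0.
  by case/eqP: ai; apply: val_inj; rewrite /= ib ab.
rewrite (mul_flag_mx qn) gP; last by rewrite /blk /=; have := ltn_ord j; lia.
rewrite mxE big1 // => a _; rewrite mxE big1 ?mul0r // => b _.
rewrite !mxE; case: eqP => [ib|]; last by rewrite mul0r.
by have := ltn_ord b; lia.
Qed.

Lemma flag_rational n l : is_rational l (flag_prerep n (n - l)).
Proof.
split=> /= [|g h gP hP|i j].
- by rewrite mulmx1 flag_mxK // leq_subr.
- by rewrite -[in RHS]mulmxA flag_invariant // !mulmxA.
- exact: (@rat_regular_mul k n l (nat_prerep n) _ _ _ _ i j (nat_rational n l)).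
Qed.

Definition flag_rep n l : rep n l := Rep (@flag_rational n l).

Lemma flag_equivariant n l :
  flag_mx n (n - l) \in @equivariant k n l (flag_prerep n (n - l)) (nat_prerep n).
Proof. by apply/equivariantP => g gP; exact: flag_invariant. Qed.

(** If [v] lies in the image and its coordinate [v_i] is nonzero, then [x = elem_mx j i 1] gives
    [(x - 1) v = v_i e_j]. This reaches each basis vector [e_j] of the first block with [j != i]. *)
Lemma nat_image_flag n l (S : @prerep k n) (F : equivar l S (nat_prerep n))
    (u : 'cV_(rdim S)) :
  emx F *m u != 0 -> (1 < n - l)%N ->
  exists J : 'M_(rdim S, n - l), emx F *m J = flag_mx n (n - l).
Proof.
move=> Fu N1.
have hit (w : 'cV_(rdim S)) (i j : 'I_n) : (emx F *m w) i 0 != 0 -> j != i ->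
    (j < n - l)%N -> exists w' : 'cV_(rdim S), emx F *m w' = delta_mx j 0.
  move=> wi ji jN; pose x := elem_mx j i (1 : k).
  have xP : x \in parab l by apply: elem_mx_parab; rewrite // /blk; lia.
  exists (((emx F *m w) i 0)^-1 *: (ract S x *m w - w)).
  rewrite -scalemxAr mulmxBr mulmxA equivarP // -mulmxA.
  rewrite /= /x /elem_mx scale1r mulmxDl mul1mx [_ + _ *m _]addrC addrK.
  move: (emx F *m w) wi => v wi.
  apply/matrixP => a b; rewrite (ord1 b) !mxE (bigD1 i) //= big1 => [|c ci].
    by rewrite !mxE eqxx !andbT addr0 mulrCA mulVf // mulr1.
  by rewrite !mxE (negPf ci) andbF mul0r.
have [i ui] : exists i, (emx F *m u) i 0 != 0.
  apply: contrapT => no; case/eqP: Fu; apply/matrixP => i b; rewrite (ord1 b) [RHS]mxE.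
  by apply/eqP; apply: contrapT => /negP h; apply: no; exists i.
have all (j : 'I_n) : (j < n - l)%N ->
    exists w : 'cV_(rdim S), emx F *m w = delta_mx j 0.
  move=> jN; have [ji|ji] := eqVneq j i; last exact: hit ui _ _.
  have n0 : (0 < n)%N by lia.
  have n1 : (1 < n)%N by lia.
  (* For [j = i] the vector is reached through a second index of the first block, which exists since
     [1 < n - l]. *)
  pose i' : 'I_n := if (0 < j)%N then Ordinal n0 else Ordinal n1.
  have i'j : i' != j by rewrite /i' -val_eqE; case: (ltnP 0 j) => /= h; lia.
  have i'N : (i' < n - l)%N by rewrite /i'; case: (ltnP 0 j) => /= h; lia.
  have [w wE] : exists w : 'cV_(rdim S), emx F *m w = delta_mx i' 0.
    by apply: hit ui _ i'N; rewrite -ji.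
  by apply: (hit w i'); rewrite ?wE ?mxE ?eqxx ?oner_neq0 // eq_sym.
have qn := leq_subr l n.
have [w wE] := choice (fun j : 'I_(n - l) => all (widen_ord qn j) (ltn_ord j)).
exists (\matrix_(a, j) w j a 0); apply/matrixP => a j.
have /matrixP/(_ a 0) := wE j; rewrite !mxE eqxx andbT => e.
by rewrite -[RHS]e; apply: eq_bigr => b _; rewrite mxE.
Qed.

End NaturalRepresentation.

Lemma ker_incl_lift (k : fieldType) n m (X Y : @rep k n m) (F : equivar m X Y)
    p (v : 'M_(rdim X, p)) :
  emx F *m v = 0 -> exists c, v = emx (ker_incl F) *m c.
Proof.
move=> Fv; have /submxP[D vD] : (v^T <= row_base (kermx (emx F)^T))%MS.
  by rewrite eq_row_base; apply/sub_kermxP; rewrite -trmx_mul Fv trmx0.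
by exists D^T; apply: trmx_inj; rewrite vD trmx_mul !trmxK.
Qed.

Lemma row_free_tr_inj (k : fieldType) p q r (A : 'M[k]_(p, q)) (B C : 'M_(q, r)) :
  row_free A^T -> A *m B = A *m C -> B = C.
Proof.
move=> Afree /(congr1 trmx); rewrite !trmx_mul => /(row_free_inj Afree).
exact: trmx_inj.
Qed.

Lemma flag_mxM (k : fieldType) n q r : (r <= q)%N -> (q <= n)%N ->
  flag_mx k n q *m flag_mx k q r = flag_mx k n r.
Proof.
by move=> rq qn; apply/matrixP => i j; rewrite (mul_flag_mx rq) !mxE.
Qed.

(** * Monomorphisms of the direct limit *)

Section MonomorphismsInCt.
Variables (k : fieldType) (U : ultrafilter posnat).
Implicit Types X Y Z : Ct k U.

Lemma Ct_cls0 l X Y : Ct_cls (0 : hom_at l X Y) = 0.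
Proof.
have := @Ct_cls_is_linear k U l X Y (-1) 0 0.
by rewrite scaler0 addr0 scaleN1r addNr.
Qed.

Lemma Ct_row_free_mono l X Y
    (F : forall n, equivar l (Ct_under X n) (Ct_under Y n)) :
  uset U [set n | row_free (emx (F n))^T]%classic ->
  @is_mono _ (Ct k U) X Y (Ct_cls (germ U F : hom_at l X Y)).
Proof.
move=> Ffree Z g h; have [a aP] := Ct_common2 g h.
have [g' [h' [-> ->]]] := aP _ (leq_maxl a l); have ll := leq_maxr a l.
have [G ->] := hom_at_germ g'; have [H ->] := hom_at_germ h'.
rewrite -(Ct_cls_up ll) [hom_up _ _ _ _]gres_germ /= !Ct_comp_cls !comp_at_germ.
move=> /Ct_cls_inj/germP e; congr Ct_cls; apply/germP.
apply: filterS2 Ffree e => n Fn /(congr1 (fun A => (emx A)^T)) /=.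
by rewrite !trmx_mul => /(row_free_inj Fn)/trmx_inj; exact: val_inj.
Qed.

(** The test object must be generated. Writing [X] as a quotient of a subobject [T] of a mixed sum,
    the kernel [W] of the composite from [T] to [Y] is again a subobject of that sum. Its map to [X]
    is killed by the monomorphism, hence zero, and it covers the kernel of [F]. *)
Lemma Ct_mono_row_free l X Y
    (F : forall n, equivar l (Ct_under X n) (Ct_under Y n)) :
  (tag X <= l)%N -> (tag Y <= l)%N ->
  @is_mono _ (Ct k U) X Y (Ct_cls (germ U F : hom_at l X Y)) ->
  uset U [set n | row_free (emx (F n))^T]%classic.
Proof.
move=> Xl Yl Fm.
pose X' : uRepP U l := sval (res_ob Xl (tagged X)).
pose Y' : uRepP U l := sval (res_ob Yl (tagged Y)).
have [s [T [i [p [im pe]]]]] : Defs.generated X' := svalP (res_ob Xl (tagged X)).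
have [p' ep] := germ_surj p; rewrite {}ep in pe; move/uepiP: pe => pe.
pose G n : @equivar k (sval n) l (T n) (Y' n) := equivar_comp (F n) (p' n).
pose W : uRepP U l := fun n => ker_rep (G n).
pose inc : @mor _ (uRepP U l) W T := germ U (fun n => ker_incl (G n)).
have incm : is_mono inc.
  apply/umonoP; apply: filterE => n.
  by rewrite /ker_incl /= trmxK row_base_free.
have Wgen : Defs.generated W.
  exists s, W, (Defs.comp i inc), (idm W); split; last exact: is_epi_id.
  exact: is_mono_comp.
pose WO : Ct k U := Tagged (fun m => RepPt U m : Type) (exist _ W Wgen : RepPt U l).
pose H n : @equivar k (sval n) l (Ct_under WO n) (Ct_under X n) :=
  equivar_comp (p' n) (ker_incl (G n)).
have H0 : (germ U H : hom_at l WO X) = 0.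
  apply: Ct_cls_eq0; apply: Fm; rewrite comp_zeror.
  rewrite [LHS]Ct_comp_cls comp_at_germ (_ : germ U _ = 0); first exact: Ct_cls0.
  apply/germP; apply: filterE => n; apply: val_inj => /=.
  by have /(congr1 val) := ker_inclK (G n); rewrite /= mulmxA.
move/germP: H0 => H0; apply: filterS2 pe H0 => n /row_freeP[t pt] /= Hn.
apply: inj_row_free => v vF; apply: trmx_inj; rewrite trmx0.
have Fv : emx (F n) *m v^T = 0 by rewrite -[emx _]trmxK -trmx_mul vF trmx0.
have [c tc] : exists c, t *m v^T = emx (ker_incl (G n)) *m c.
  (* [t] is a right inverse of [p' n], so [t *m v^T] is a preimage of [v^T] in the kernel of
     [G n]. *)
  by apply: ker_incl_lift; rewrite /= -mulmxA [p' n *m _]mulmxA pt mul1mx.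
rewrite -[v^T]mul1mx -pt -mulmxA tc mulmxA.
by have /(congr1 val) /= -> := Hn; rewrite mul0mx.
Qed.

Lemma Ct_zero_ae X : @is_zero _ (Ct k U) X <->
  uset U [set n | rdim (Ct_under X n) = 0%N]%classic.
Proof.
split=> [/Ct_cls_eq0/germP h|h].
  apply: filterS h => n /(congr1 val) /= e.
  by move/eqP: (mxrank1 k (rdim (Ct_under X n))); rewrite e mxrank0 => /eqP.
rewrite /is_zero /= /Ct_id (_ : gid U (tag X) (Ct_under X) = 0); last first.
  apply/germP; apply: filterS h => n /= n0; apply: val_inj => /=.
  by apply/matrixP => i; have := ltn_ord i; rewrite {2}n0.
exact: Ct_cls0.
Qed.

Lemma Ct_iso_ae l X Y (F : forall n, equivar l (Ct_under X n) (Ct_under Y n)) :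
  @is_iso _ (Ct k U) X Y (Ct_cls (germ U F : hom_at l X Y)) ->
  uset U [set n | rdim (Ct_under Y n) <= rdim (Ct_under X n)]%classic%N.
Proof.
move=> [g [_ Fg]]; have [a aP] := Ct_cls_surj g.
pose b := maxn (maxn a l) (tag Y).
have ab : (a <= b)%N by rewrite /b; lia.
have lb : (l <= b)%N by rewrite /b; lia.
have Yb : (tag Y <= b)%N by rewrite /b; lia.
have [g' eg] := aP b ab; have [G eG] := hom_at_germ g'.
move: Fg; rewrite eg eG -(Ct_cls_up lb) [hom_up _ _ _ _]gres_germ.
rewrite [LHS]Ct_comp_cls comp_at_germ [RHS](Ct_idE Yb) => /Ct_cls_inj/germP e.
apply: filterS e => n /(congr1 val) /= e.
rewrite -(mxrank1 k (rdim (Ct_under Y n))) -e.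
exact: leq_trans (mxrankM_maxl _ _) (rank_leq_col _).
Qed.

End MonomorphismsInCt.

(** * The natural object has no simple subobject *)

Section InfiniteLength.
Variables (k : fieldType) (U : ultrafilter posnat).

Lemma unat_embed m : exists i : mor (unat U m) (mixed_sum U m [:: [:: true]]),
  @is_mono _ (uRepP (k := k) U m) _ _ i.
Proof.
exists (germ U (fun n => Equivar (nat_tensor_equivariant k (sval n) m))).
by apply/umonoP; apply: filterE => n; exact: nat_tensor_free.
Qed.

Lemma unat_sub_generated m (W : uRepP (k := k) U m) (f : mor W (unat U m)) :
  is_mono f -> Defs.generated W.
Proof.
move=> fm; have [i im] := unat_embed m.
exists [:: [:: true]], W, (Defs.comp i f), (idm W).
by split; [exact: is_mono_comp | exact: is_epi_id].
Qed.

Lemma unat_generated m : Defs.generated (@unat k U m).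
Proof.
by apply: (unat_sub_generated (f := idm (unat U m))) => W a b; rewrite !comp1m.
Qed.

Definition Ct_nat : Ct k U :=
  Tagged (fun m => RepPt U m : Type) (exist _ _ (unat_generated 0) : RepPt U 0).

Definition uflag m : uRepP (k := k) U m := fun n => flag_rep k (sval n) m.

Lemma uflag_generated m : Defs.generated (uflag m).
Proof.
pose F n : @equivar k (sval n) m (uflag m n) (unat U m n) :=
  @Equivar k _ _ (uflag m n) (unat U m n) _ (flag_equivariant k (sval n) m).
apply: (unat_sub_generated (f := germ U F)).
apply/umonoP; apply: filterE => n.
by apply: left_inverse_row_free; exact: flag_mxK (leq_subr _ _).
Qed.

Definition Ct_flag m : Ct k U :=
  Tagged (fun m => RepPt U m : Type) (exist _ _ (uflag_generated m) : RepPt U m).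

Lemma Ct_nat_no_simple_sub (S : Ct k U) (f : mor S Ct_nat) :
  nonprincipal U -> is_mono f -> ~ is_simple S.
Proof.
move=> npU fm [S0 Ssimple]; have [a aP] := Ct_cls_surj f.
pose l := maxn a (tag S); have Sl : (tag S <= l)%N by rewrite leq_maxr.
have [f' ef] := aP l (leq_maxl _ _); have [F eF] := hom_at_germ f'.
rewrite {}ef {}eF in fm.
have Ffree := @Ct_mono_row_free k U l S Ct_nat F Sl (leq0n l) fm.
have Spos : uset U [set n | rdim (Ct_under S n) <> 0%N]%classic.
  have [h|//] := in_ultra_setVsetC [set n | rdim (Ct_under S n) = 0%N]%classic
    (uset_ultra U).
  by case: S0; apply/Ct_zero_ae.
(* This yields both [1 < n - l], as [nat_image_flag] requires, and a nonzero flag at level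
   [l.+1]. *)
have big := nonprincipal_gt l.+1 npU.
pose good (n : posnat) := [/\ row_free (emx (F n))^T, (l.+1 < sval n)%N &
  exists J : 'M_(rdim (Ct_under S n), sval n - l),
    emx (F n) *m J = flag_mx k (sval n) (sval n - l)].
have img : uset U good.
  apply: filterS2 Spos (filterI Ffree big) => n /= Sn [Fn nl]; split=> //.
  apply: (nat_image_flag (u := const_mx 1)); last by lia.
  have Sn0 : (0 < rdim (Ct_under S n))%N by rewrite lt0n; apply/eqP.
  apply/eqP; rewrite -(mulmx0 _ (emx (F n))) => /(row_free_tr_inj Fn).
  move/matrixP/(_ (Ordinal Sn0) 0); rewrite !mxE => /eqP.
  by rewrite oner_eq0.
pose q n := (n - l.+1)%N.
have jex n : exists j : @equivar k (sval n) l.+1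
    (flag_prerep k (sval n) (q (sval n))) (Ct_under S n),
    good n -> emx (F n) *m emx j = flag_mx k (sval n) (q (sval n)).
  have [[Fn nl [J FJ]]|no] := pselect (good n); last by exists 0.
  (* [J] lifts the flag of level [l] along [F n]; its first [n - l - 1] columns lift the smaller
     flag. *)
  pose j := J *m flag_mx k (sval n - l) (q (sval n)).
  have Fj : emx (F n) *m j = flag_mx k (sval n) (q (sval n)).
    by rewrite mulmxA FJ flag_mxM ?leq_subr // leq_sub2l.
  have jP : j \in @equivariant k (sval n) l.+1
      (flag_prerep k (sval n) (q (sval n))) (Ct_under S n).
    (* Equivariance of [j] can be tested after composition with the injective [F n]. *)
    apply/equivariantP => g gP; apply: (row_free_tr_inj Fn).
    rewrite [LHS]mulmxA Fj [LHS]flag_invariant // [RHS]mulmxA.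
    by rewrite (equivarP (F n) (parab_sub (leqnSn l) gP)) -mulmxA Fj.
  by exists (Equivar jP).
pose j n := sval (cid (jex n)); have jE n := svalP (cid (jex n)).
pose g : mor (Ct_flag l.+1) S := Ct_cls (germ U j : hom_at l.+1 (Ct_flag l.+1) S).
have gm : is_mono g.
  apply: Ct_row_free_mono; apply: filterS img => n /jE Fj.
  pose L := (flag_mx k (sval n) (q (sval n)))^T *m emx (F n).
  apply: (left_inverse_row_free (L := L)).
  by rewrite /L -mulmxA Fj flag_mxK // leq_subr.
(* The flag has dimension [n - l - 1], which is positive, while [S] has dimension at least [n - l];
   so both alternatives fail. *)
case: (Ssimple _ g gm) => [/Ct_zero_ae|/Ct_iso_ae] h.
  by have [n /= [h1 h2]] := filter_ex (filterI h big); move: h1; rewrite /=; lia.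
have [n /= [h1 [Fn nl [J FJ]]]] := filter_ex (filterI h img).
have : (sval n - l <= rdim (Ct_under S n))%N.
  rewrite -(mxrank1 k (sval n - l)) -(flag_mxK k (leq_subr l (sval n))) -FJ mulmxA.
  exact: leq_trans (mxrankM_maxr _ _) (rank_leq_row _).
by move=> h2; have := leq_trans h2 h1; rewrite /=; lia.
Qed.

Lemma Ct_nat_infinite_length : nonprincipal U -> ~ finite_length Ct_nat.
Proof.
move=> npU /finite_length_simple_sub[/Ct_zero_ae h|[S [f [Ss fm]]]].
  have [n /= n0] := filter_ex h; have := svalP n.
  by move: n0; rewrite /=; lia.
exact: Ct_nat_no_simple_sub fm Ss.
Qed.

End InfiniteLength.

Theorem propositionA1 (k : fieldType) (k_char0 : [pchar k]%R =i pred0)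
    (U : ultrafilter posnat) (U_nonprincipal : nonprincipal U) :
  (forall X Y : Ct k U, findim (mor X Y)) /\
  (exists X : Ct k U, ~ finite_length X).
Proof.
split; first exact: Ct_hom_findim.
by exists (Ct_nat k U); exact: Ct_nat_infinite_length.
Qed.
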